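(* For $f,h\in C^\infty(\mathfrak M)_{\mathrm{red}}$, the second reduced Poisson bracket is given, with all derivatives at $(e^q,J)$, by $$2\{f,h\}_2^{\mathrm{red}}(e^q,J)=\langle\nabla_1f,(\nabla_2h+\nabla_2'h)^-_0\rangle-\langle\nabla_1h,(\nabla_2f+\nabla_2'f)^-_0\rangle+\langle R(q)[d_2f,J]^+,(\nabla_2h+\nabla_2'h)^-\rangle-\langle R(q)[d_2h,J]^+,(\nabla_2f+\nabla_2'f)^-\rangle$$ $$\qquad+\langle(\nabla_2f)^-,(\nabla_2'h)^-\rangle+\langle(\nabla_2'f)^+,(\nabla_2h)^+\rangle-\langle(\nabla_2'f)^-,(\nabla_2h)^-\rangle-\langle(\nabla_2f)^+,(\nabla_2'h)^+\rangle .$$ If $h$ is the restriction $H\circ\iota$ of any of the functions $H_k(g,J)=\frac1k\Re\operatorname{tr}(J^k)$ or $\tilde H_k(g,J)=\frac1k\Im\operatorname{tr}(J^k)$ ($k\ge1$), this can be written as $$\{f,h\}_2^{\mathrm{red}}(e^q,J)=\langle\nabla_1f,(\nabla_2h)^-_0\rangle+\langle d_2f,[R(q)(\nabla_2h)^--(\nabla_2h)^+,J]\rangle .$$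
   Context: $G=\mathrm{GL}(n,\mathbb C)$ (real Lie group), $\mathcal G=\mathfrak{gl}(n,\mathbb C)$ (real Lie algebra) with $\langle X,Y\rangle=\Re\operatorname{tr}(XY)$; $X=X_>+X_0+X_<$ (strictly upper, diagonal, strictly lower parts), $r(X)=\frac12(X_>-X_<)$, $r_\pm=r\pm\frac12\mathrm{id}$. $\mathcal G^+=\mathfrak u(n)$ (anti-Hermitian), $\mathcal G^-=\mathrm i\,\mathfrak u(n)$ (Hermitian); $X=X^++X^-$ with $X^\pm=\frac12(X\mp X^* )$; $\mathcal G^\pm_0$ are the diagonal matrices in $\mathcal G^\pm$ and $X^-_0$ is the diagonal part of $X^-$. $\mathfrak M=G\times\mathcal G=\{(g,J)\}$. For $F\in C^\infty(\mathfrak M,\mathbb R)$: $\langle\nabla_1F,X\rangle=\frac{d}{dt}|_0F(e^{tX}g,J)$, $\langle\nabla_1'F,X\rangle=\frac{d}{dt}|_0F(ge^{tX},J)$, $\langle d_2F,X\rangle=\frac{d}{dt}|_0F(g,J+tX)$ for $X\in\mathcal G$, $\nabla_2F=J\,d_2F$, $\nabla_2'F=(d_2F)J$. The second Poisson bracket on $\mathfrak M$ is $\{F,H\}_2=\langle r\nabla_1F,\nabla_1H\rangle-\langle r\nabla_1'F,\nabla_1'H\rangle+\langle \nabla_2F-\nabla_2'F, r_+\nabla_2'H-r_-\nabla_2H\rangle+\langle\nabla_1F, r_+\nabla_2'H-r_-\nabla_2H\rangle-\langle\nabla_1H, r_+\nabla_2'F-r_-\nabla_2F\rangle$. For $\eta\in\mathrm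 U(n)$, $\mathcal R_\eta(g,J)=(g\eta^{-1},J)$, $\mathcal L_\eta(g,J)=(\eta g,\eta J\eta^{-1})$; $C^\infty(\mathfrak M)^{\mathrm U(n)\times\mathrm U(n)}$ is the set of smooth real functions invariant under all these maps (it is closed under $\{\ ,\ \}_2$). Let $\mathfrak M_0^{\mathrm{reg}}=\{(e^q,J): J\in\mathcal G,\ q=\mathrm{diag}(q_1,\dots,q_n)\in\mathcal G_0^-,\ q_1>\dots>q_n\}$ with inclusion $\iota$, and $C^\infty(\mathfrak M)_{\mathrm{red}}=\{F\circ\iota: F\in C^\infty(\mathfrak M)^{\mathrm U(n)\times\mathrm U(n)}\}$; $\{F\circ\iota,H\circ\iota\}_2^{\mathrm{red}}=\{F,H\}_2\circ\iota$. For $f\in C^\infty(\mathfrak M_0^{\mathrm{reg}})$: $\nabla_1f\in\mathcal G^-_0$ with $\langle\nabla_1f,X_0\rangle=\frac{d}{dt}|_0f(e^{q+tX_0},J)$ ($X_0\in\mathcal G_0^-$), $d_2f\in\mathcal G$ with $\langle d_2f,X\rangle=\frac{d}{dt}|_0f(e^q,J+tX)$, $\nabla_2f=J\,d_2f$, $\nabla_2'f=(d_2f)J$. $R(q)\in\mathrm{End}(\mathcal G)$: $(R(q)X)_{ii}=0$, $(R(q)X)_{ij}=X_{ij}\coth(q_i-q_j)$ for $i\ne j$. *)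

(* Defs.v *)
From HB Require Import structures.
From mathcomp Require Import all_boot all_order all_algebra.
From mathcomp Require Import all_classical all_reals all_analysis.
From mathcomp Require Import complex.
Set Implicit Arguments.
Unset Strict Implicit.
Unset Printing Implicit Defensive.
Import Order.TTheory GRing.Theory Num.Theory.
Import numFieldNormedType.Exports numFieldTopology.Exports.
Local Open Scope classical_set_scope.
Local Open Scope ring_scope.
Local Open Scope complex_scope.

(* the usual (modulus) metric topology on C = R[i]; matrices and pairs of
   matrices then get the product topologies from MathComp-Analysis *)
HB.instance Definition _ (R : realType) := PseudoPointedMetric.copy R[i] (R[i])^o.

Section Defs.
Variables (R : realType) (n : nat).

Local Notation C := (R[i]).
Local Notation Mx := ('M[C]_n).

Definition rc (t : R) : C := t%:C.

Definition ip (X Y : Mx) : R := complex.Re (\tr (X *m Y)).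

Definition adj (X : Mx) : Mx := map_mx (@conjc R) X^T.

Definition pplus (X : Mx) : Mx := rc (2^-1) *: (X - adj X).
Definition pminus (X : Mx) : Mx := rc (2^-1) *: (X + adj X).

Definition supp (X : Mx) : Mx := \matrix_(i, j) if (i < j)%N then X i j else 0.
Definition slow (X : Mx) : Mx := \matrix_(i, j) if (j < i)%N then X i j else 0.
Definition dgp (X : Mx) : Mx := \matrix_(i, j) if i == j then X i j else 0.

Definition pminus0 (X : Mx) : Mx := dgp (pminus X).

Definition rmat (X : Mx) : Mx := rc (2^-1) *: (supp X - slow X).
Definition rplus (X : Mx) : Mx := rmat X + rc (2^-1) *: X.
Definition rminus (X : Mx) : Mx := rmat X - rc (2^-1) *: X.

Definition comm (X Y : Mx) : Mx := X *m Y - Y *m X.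

Definition mexp (X : Mx) : Mx :=
  lim ((fun N : nat => \sum_(k < N) rc (k`!%:R)^-1 *: X ^+ k) @ \oo).

(* the Riesz representative w.r.t. <.,.> of a real-linear form L on G:
   the unique Y with <Y, X> = L X (for linear L); explicitly
   Y_(a,b) = L(E_ba) - i L(i E_ba) *)
Definition grad (L : Mx -> R) : Mx :=
  \matrix_(a, b) (rc (L (delta_mx b a)) - 'i * rc (L ('i *: delta_mx b a))).

(* --- functions on M = GL(n,C) x G (extended arbitrarily outside) --- *)
Definition GLset : set (Mx * Mx) := [set p | p.1 \in unitmx].

Definition dirD (F : Mx * Mx -> R) (v : Mx * Mx) (x : Mx * Mx) : R :=
  derive1 (fun t : R => F (x.1 + rc t *: v.1, x.2 + rc t *: v.2)) 0.

Fixpoint iterD (vs : seq (Mx * Mx)) (F : Mx * Mx -> R) : Mx * Mx -> R :=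
  match vs with
  | [::] => F
  | v :: vs' => dirD (iterD vs' F) v
  end.

Definition smooth (F : Mx * Mx -> R) : Prop :=
  forall vs : seq (Mx * Mx), forall x, GLset x ->
    {for x, continuous (iterD vs F)} /\
    forall v : Mx * Mx,
      derivable (fun t : R => iterD vs F (x.1 + rc t *: v.1, x.2 + rc t *: v.2)) 0 1.

Definition unitary (eta : Mx) : Prop := eta *m adj eta = 1%:M.

Definition UUinvariant (F : Mx * Mx -> R) : Prop :=
  forall eta : Mx, unitary eta -> forall g J : Mx, g \in unitmx ->
    F (g *m invmx eta, J) = F (g, J) /\
    F (eta *m g, eta *m J *m invmx eta) = F (g, J).

Definition nabla1 (F : Mx * Mx -> R) (g J : Mx) : Mx :=
  grad (fun X => derive1 (fun t : R => F (mexp (rc t *: X) *m g, J)) 0).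
Definition nabla1' (F : Mx * Mx -> R) (g J : Mx) : Mx :=
  grad (fun X => derive1 (fun t : R => F (g *m mexp (rc t *: X), J)) 0).
Definition d2 (F : Mx * Mx -> R) (g J : Mx) : Mx :=
  grad (fun X => derive1 (fun t : R => F (g, J + rc t *: X)) 0).
Definition nabla2 (F : Mx * Mx -> R) (g J : Mx) : Mx := J *m d2 F g J.
Definition nabla2' (F : Mx * Mx -> R) (g J : Mx) : Mx := d2 F g J *m J.

Definition bracket2 (F H : Mx * Mx -> R) (g J : Mx) : R :=
  ip (rmat (nabla1 F g J)) (nabla1 H g J)
  - ip (rmat (nabla1' F g J)) (nabla1' H g J)
  + ip (nabla2 F g J - nabla2' F g J)
       (rplus (nabla2' H g J) - rminus (nabla2 H g J))
  + ip (nabla1 F g J) (rplus (nabla2' H g J) - rminus (nabla2 H g J))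
  - ip (nabla1 H g J) (rplus (nabla2' F g J) - rminus (nabla2 F g J)).

Definition regular (q : 'rV[R]_n) : Prop :=
  forall i j : 'I_n, (i < j)%N -> q 0 j < q 0 i.

Definition diagq (q : 'rV[R]_n) : Mx := diag_mx (map_mx rc q).
Definition expq (q : 'rV[R]_n) : Mx := diag_mx (map_mx (fun x => rc (expR x)) q).

Definition restr (F : Mx * Mx -> R) : 'rV[R]_n -> Mx -> R :=
  fun q J => F (expq q, J).

(* reduced gradients: nabla_1 f in G_0^- (real diagonal), with
   <nabla_1 f, X_0> = d/dt f(e^(q + t X_0), J) *)
Definition rnabla1 (f : 'rV[R]_n -> Mx -> R) (q : 'rV[R]_n) (J : Mx) : Mx :=
  diag_mx (\row_i rc (derive1 (fun t : R => f (q + t *: delta_mx 0 i) J) 0)).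
Definition rd2 (f : 'rV[R]_n -> Mx -> R) (q : 'rV[R]_n) (J : Mx) : Mx :=
  grad (fun X => derive1 (fun t : R => f q (J + rc t *: X)) 0).
Definition rnabla2 f q J : Mx := J *m rd2 f q J.
Definition rnabla2' f q J : Mx := rd2 f q J *m J.

Definition coth (x : R) : R := (expR x + expR (- x)) / (expR x - expR (- x)).
Definition Rq (q : 'rV[R]_n) (X : Mx) : Mx :=
  \matrix_(i, j) if i == j then 0 else X i j * rc (coth (q 0 i - q 0 j)).

Definition Hk (k : nat) : Mx * Mx -> R := fun p => k%:R^-1 * complex.Re (\tr (p.2 ^+ k)).
Definition Htk (k : nat) : Mx * Mx -> R := fun p => k%:R^-1 * complex.Im (\tr (p.2 ^+ k)).

End Defs.

(* Main.v *)
(* Write a = nabla_1 F, P = [d_2 F, J], and b, Q for the same data of H.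
   Invariance under the two U(n) actions says that nabla_1' F = e^-q a e^q and
   a - P are Hermitian.  Hence a^+ = P^+, and comparing the entries of a with
   those of the Hermitian matrix e^-q a e^q turns e^(q_i - q_j) into
   coth (q_i - q_j), so that a^- = nabla_1 f + R(q) P^+.  Since r and R(q) are
   commuting antisymmetric entrywise multipliers exchanging G^+ and G^-, all
   terms with r cancel, and the rest is bilinear algebra for the trace form.
   The only analysis needed is the chain rule for F along matrix curves, which
   is deduced from directional differentiability by the mean value theorem. *)
Require Import Defs.
From HB Require Import structures.
From mathcomp Require Import all_boot all_order all_algebra.
From mathcomp Require Import all_classical all_reals all_analysis.
From mathcomp Require Import complex.
From mathcomp Require Import ring lra.
Import Order.TTheory GRing.Theory Num.Theory.
Import numFieldNormedType.Exports numFieldTopology.Exports.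
Local Open Scope ring_scope.

Set Implicit Arguments.
Unset Strict Implicit.
Unset Printing Implicit Defensive.
Local Open Scope classical_set_scope.
Local Open Scope complex_scope.

(** * Topology of complex matrices through real and imaginary parts of entries *)

Section ComplexTopology.
Variable R : realType.

(** Two obstacles shape the analysis. [smooth] speaks only of derivatives along straight lines in
    fixed directions, so a matrix curve is reached by one shift per real coordinate, and each shift
    is differentiated separately. And [nabla1], [nabla1'] are defined through [mexp], a limit of
    partial sums. Since [grad] evaluates a functional only on the matrices [E_ab] and [i E_ab], the
    exponential is needed only for their real multiples, which square to zero for [a <> b] and are
    multiples of an idempotent for [a = b]; both cases have closed forms. Likewise, invariance is
    tested only on anti-Hermitian [A] with [A^3 = - A], whose unitary one-parameter groups are
    explicit; these [A] still span u(n), and orthogonality to u(n) means being Hermitian. The second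
    formula is computed directly from the bracket: for trace powers [nabla1 H = 0] and
    [N = nabla2 H = nabla2' H] commutes with [J], so only <a - P, N> survives, and <P, N> = 0. *)

Lemma normC_leD (z : R[i]) : `|z| <= rc (`|complex.Re z| + `|complex.Im z|).
Proof.
rewrite {1}[z]complexE; apply: (le_trans (ler_normD _ _)).
rewrite normrM normCi mul1r !normc_def /= !expr0n /= !addr0 !sqrtr_sqr.
by rewrite /rc rmorphD.
Qed.

Lemma nbhs_complex (z : R[i]) (A : set R[i]) : nbhs z A ->
  exists2 e : R, 0 < e & forall w, `|complex.Re z - complex.Re w| < e ->
    `|complex.Im z - complex.Im w| < e -> A w.
Proof.
move/nbhs_ballP => [e /= e0 eA].
have eE : e = rc (complex.Re e) by rewrite /rc RRe_real // gtr0_real.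
have e'0 : 0 < complex.Re e by move: e0; rewrite {1}eE /rc ltcR.
exists (complex.Re e / 2); first by rewrite divr_gt0.
move=> w rw iw; apply: eA; rewrite /ball/=.
apply: (le_lt_trans (normC_leD _)); rewrite eE /rc ltcR.
by rewrite !raddfB /= [ltRHS]splitr ltrD.
Qed.

Lemma cvg_complex (T : Type) (F : set_system T) (FF : Filter F) (u : T -> R[i]) z :
  complex.Re (u t) @[t --> F] --> complex.Re z ->
  complex.Im (u t) @[t --> F] --> complex.Im z -> u t @[t --> F] --> z.
Proof.
move=> ru iu A /nbhs_complex[e e0 eA].
move/cvgrPdist_lt : ru => /(_ e e0) ru; move/cvgrPdist_lt : iu => /(_ e e0) iu.
by near=> t; apply: eA; near: t.
Unshelve. all: by end_near. Qed.

Lemma cvg_mxC (T : Type) (F : set_system T) (FF : Filter F) m n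
    (u : T -> 'M[R[i]]_(m, n)) (l : 'M[R[i]]_(m, n)) :
  (forall i j, complex.Re (u t i j) @[t --> F] --> complex.Re (l i j)) ->
  (forall i j, complex.Im (u t i j) @[t --> F] --> complex.Im (l i j)) ->
  u t @[t --> F] --> l.
Proof.
move=> ru iu A [P lP PA].
have : \forall t \near F, forall i j, P i j (u t i j).
  apply: filter_forall => i; apply: filter_forall => j.
  exact: (@cvg_complex _ F FF (fun t => u t i j) _ (ru i j) (iu i j) _ (lP i j)).
by apply: filterS => t; apply: PA.
Qed.

(** Needed to identify the [lim] in [mexp] with a computed limit. Neighbourhoods of an entry pull
    back to cylinders, so matrices that cannot be separated agree entry by entry. *)
Lemma mxC_hausdorff m n : hausdorff_space 'M[R[i]]_(m, n).
Proof.
move=> p q pq; apply/matrixP => i j.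
apply: (@norm_hausdorff _ (R[i])^o) => A B Ap Bq.
have [r [pr qr]] : [set M : 'M[R[i]]_(m, n) | A (M i j)] `&`
    [set M : 'M[R[i]]_(m, n) | B (M i j)] !=set0.
  apply: pq.
  - exists (fun i' j' => if (i' == i) && (j' == j) then A else setT).
      move=> i' j'; case: ifP => [/andP[/eqP-> /eqP->]//|_]; exact: filterT.
    by move=> M /(_ i j); rewrite !eqxx.
  - exists (fun i' j' => if (i' == i) && (j' == j) then B else setT).
      move=> i' j'; case: ifP => [/andP[/eqP-> /eqP->]//|_]; exact: filterT.
    by move=> M /(_ i j); rewrite !eqxx.
by exists (r i j).
Qed.

End ComplexTopology.

(** * Entrywise convergence, and openness of the set of invertible matrices *)

Section EntrywiseCvg.
Variable R : realType.

(** The working notion of convergence: limits are computed in [R], and [ecvg_cvg] passes to the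
    matrix topology at the end. *)
Definition ecvg (T : Type) (F : set_system T) m n (u : T -> 'M[R[i]]_(m, n))
    (l : 'M[R[i]]_(m, n)) : Prop :=
  forall i j, (complex.Re (u t i j) @[t --> F] --> complex.Re (l i j)) /\
              (complex.Im (u t i j) @[t --> F] --> complex.Im (l i j)).

Lemma ecvg_cvg (T : Type) (F : set_system T) (FF : Filter F) m n
    (u : T -> 'M[R[i]]_(m, n)) l : ecvg F u l -> u t @[t --> F] --> l.
Proof. by move=> ul; apply: cvg_mxC => i j; have [] := ul i j. Qed.

Lemma Re_rcM (s : R) (z : R[i]) : complex.Re (rc s * z) = s * complex.Re z.
Proof. by case: z => a b; rewrite /= mul0r subr0. Qed.

Lemma Im_rcM (s : R) (z : R[i]) : complex.Im (rc s * z) = s * complex.Im z.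
Proof. by case: z => a b; rewrite /= mul0r addr0. Qed.

Lemma ecvg_shift (T : Type) (F : set_system T) (FF : Filter F) m n
    (u : T -> 'M[R[i]]_(m, n)) l (s : T -> R) (v : 'M[R[i]]_(m, n)) (s0 : R) :
  ecvg F u l -> s t @[t --> F] --> s0 ->
  ecvg F (fun t => u t + rc (s t) *: v) (l + rc s0 *: v).
Proof.
move=> ul st i j; have [ur ui] := ul i j; split.
  rewrite [X in _ --> X](_ : _ = complex.Re (l i j) + s0 * complex.Re (v i j)).
    rewrite (_ : (fun t => _) =
        (fun t => complex.Re (u t i j) + s t * complex.Re (v i j))).
      by apply: cvgD => //; apply: cvgM => //; exact: cvg_cst.
    by apply/funext => t; rewrite !mxE raddfD /= Re_rcM.
  by rewrite !mxE raddfD /= Re_rcM.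
rewrite [X in _ --> X](_ : _ = complex.Im (l i j) + s0 * complex.Im (v i j)).
  rewrite (_ : (fun t => _) =
      (fun t => complex.Im (u t i j) + s t * complex.Im (v i j))).
    by apply: cvgD => //; apply: cvgM => //; exact: cvg_cst.
  by apply/funext => t; rewrite !mxE raddfD /= Im_rcM.
by rewrite !mxE raddfD /= Im_rcM.
Qed.

Lemma mxC_coord_continuous m n i j (M : 'M[R[i]]_(m, n)) :
  (N i j : (R[i])^o) @[N --> M] --> (M i j : (R[i])^o).
Proof.
move=> A Aij; exists (fun i' j' => if (i' == i) && (j' == j) then A else setT).
  move=> i' j'; case: ifP => [/andP[/eqP-> /eqP->]//|_]; exact: filterT.
by move=> N /(_ i j); rewrite !eqxx.
Qed.

Lemma det_continuous n (M : 'M[R[i]]_n) :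
  (\det N : (R[i])^o) @[N --> M] --> (\det M : (R[i])^o).
Proof.
have FM : Filter (nbhs M) := nbhs_filter M.
apply: (@cvg_big (R[i])^o _ +%R 0); first exact: add_continuous.
move=> s _; apply: (@cvgM (R[i])); first exact: cvg_cst.
apply: (@cvg_big (R[i])^o _ *%R 1); first exact: mul_continuous.
by move=> i _; exact: mxC_coord_continuous.
Qed.

(** Invertibility is nonvanishing of the continuous function [\det]. Openness matters because
    [smooth] controls a function only on [GLset]. *)
Lemma unitmx_nbhs n (M : 'M[R[i]]_n) : M \in unitmx -> \forall N \near M, N \in unitmx.
Proof.
rewrite unitmxE unitfE => dM.
have := @cvgr_neq0 _ _ _ (nbhs M) (nbhs_filter M) _ _ (@det_continuous n M) dM.
by apply: (@filterS _ _ (nbhs_filter M)) => N; rewrite unitmxE unitfE.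
Qed.

End EntrywiseCvg.

(** * Derivative of a smooth function along a curve shifted in one direction *)

Section Step.
Variables (R : realType) (n : nat).
Local Notation Mx := 'M[R[i]]_n.
Implicit Types (F : Mx * Mx -> R) (x v : Mx * Mx).

Definition pshift x v (t : R) : Mx * Mx := (x.1 + rc t *: v.1, x.2 + rc t *: v.2).

Lemma pshift0 x v : pshift x v 0 = x.
Proof. by case: x => a b; rewrite /pshift /rc !scale0r !addr0. Qed.

Lemma pshiftD x v s t : pshift x v (s + t) = pshift (pshift x v s) v t.
Proof. by rewrite /pshift /rc /= rmorphD !scalerDl !addrA. Qed.

Lemma smooth_continuous F v x : smooth F -> GLset x -> {for x, continuous (dirD F v)}.
Proof. by move=> sF Gx; have [] := sF [:: v] x Gx. Qed.

Lemma smooth_is_derive F v x (t : R) : smooth F -> GLset (pshift x v t) ->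
  is_derive t 1 (fun s => F (pshift x v s)) (dirD F v (pshift x v t)).
Proof.
move=> sF Gx; have [_ /(_ v) dF] := sF [::] _ Gx.
have d0 : is_derive (t - t) 1 (fun s => F (pshift (pshift x v t) v s))
    (dirD F v (pshift x v t)).
  by rewrite subrr /dirD derive1E; apply: derivableP.
have dg : is_derive t 1 (fun s : R => s - t) 1.
  by apply: is_derive_eq; rewrite subr0.
have := @is_derive1_comp R _ (fun s => s - t) t _ _ d0 dg; rewrite mulr1.
rewrite (_ : _ \o _ = (fun s => F (pshift x v s))) //.
by apply/funext => s /=; rewrite -pshiftD addrC subrK.
Qed.

Lemma smooth_mean_value F v x (u : R) : smooth F ->
  (forall s, `|s| <= `|u| -> GLset (pshift x v s)) ->
  exists2 s, `|s| <= `|u| & F (pshift x v u) - F x = u * dirD F v (pshift x v s).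
Proof.
move=> sF Gx; have dF (s : R) : `|s| <= `|u| -> is_derive s 1 (fun s => F (pshift x v s))
    (dirD F v (pshift x v s)) by move=> su; exact/smooth_is_derive/Gx.
have [u0|u0] := leP 0 u.
  have su (s : R) : s \in `[0, u]%R -> `|s| <= `|u|.
    by rewrite in_itv /= => /andP[s0 su]; rewrite !ger0_norm.
  have [||s sI] := @MVT_segment R (fun s => F (pshift x v s))
      (fun s => dirD F v (pshift x v s)) 0 u u0.
  - by move=> s sI; apply/dF/su; exact: subset_itv_oo_cc.
  - by apply: derivable_within_continuous => s sI; have [] := dF s (su s sI).
  by rewrite pshift0 subr0 mulrC => ->; exists s => //; apply: su.
have su (s : R) : s \in `[u, 0]%R -> `|s| <= `|u|.
  by rewrite in_itv /= => /andP[s0 su]; rewrite !ler0_norm ?lerN2 // ltW.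
have [||s sI] := @MVT_segment R (fun s => F (pshift x v s))
    (fun s => dirD F v (pshift x v s)) u 0 (ltW u0).
- by move=> s sI; apply/dF/su; exact: subset_itv_oo_cc.
- by apply: derivable_within_continuous => s sI; have [] := dF s (su s sI).
rewrite pshift0 sub0r mulrN mulrC => e; exists s; first exact: su.
by rewrite -[LHS]opprK opprB e opprK.
Qed.

Definition pecvg (T : Type) (Fl : set_system T) (x : T -> Mx * Mx) (l : Mx * Mx) :=
  ecvg Fl (fun t => (x t).1) l.1 /\ ecvg Fl (fun t => (x t).2) l.2.

Lemma pecvg_cvg (T : Type) (Fl : set_system T) (FF : Filter Fl) (x : T -> Mx * Mx) l :
  pecvg Fl x l -> x t @[t --> Fl] --> l.
Proof.
move=> [x1 x2]; case: l x1 x2 => l1 l2 /= x1 x2.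
rewrite (_ : x = fun t => ((x t).1, (x t).2)); last by apply/funext => t; case: (x t).
exact: cvg_pair (ecvg_cvg _ x1) (ecvg_cvg _ x2).
Qed.

Lemma pecvg_shift (T : Type) (Fl : set_system T) (FF : Filter Fl) (x : T -> Mx * Mx) l
    v (s : T -> R) : pecvg Fl x l -> s t @[t --> Fl] --> 0 ->
  pecvg Fl (fun t => pshift (x t) v (s t)) l.
Proof.
move=> [x1 x2] s0; rewrite -(pshift0 l v).
by split=> /=; apply: (ecvg_shift FF).
Qed.

(* Uniform in [s]: this is what lets the mean value point vary freely. *)
Lemma near_pshift (x : R -> Mx * Mx) x0 v (A : set (Mx * Mx)) :
  pecvg (nbhs 0) x x0 -> nbhs x0 A ->
  exists2 e : R, 0 < e &
    \forall t \near 0, forall s, `|s| < e -> A (pshift (x t) v s).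
Proof.
move=> xx0 Ax0.
have x1 : pecvg (filter_prod (nbhs (0 : R)) (nbhs (0 : R))) (fun p => x p.1) x0.
  case: xx0 => a b; split=> i j; [have [c d] := a i j | have [c d] := b i j].
    by split; [apply: cvg_comp c | apply: cvg_comp d]; exact: cvg_fst.
  by split; [apply: cvg_comp c | apply: cvg_comp d]; exact: cvg_fst.
have x2 := pecvg_cvg _ (@pecvg_shift _ _ _ _ _ v snd x1 cvg_snd).
have [[P Q] /= [P0 /nbhs_ballP[e /= e0 eQ]] PQ] := x2 _ _ _ A Ax0.
exists e => //; apply: filterS P0 => t Pt s se.
by apply: (PQ (t, s)); split=> //; apply: eQ; rewrite /ball/= sub0r normrN.
Qed.

Lemma nbhs_GLset x : GLset x -> nbhs x (@GLset R n).
Proof.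
case: x => g J; rewrite /GLset /= => /unitmx_nbhs gu.
by exists ([set M | M \in unitmx], setT) => /=; [split=> //; exact: filterT | move=> [a b] []].
Qed.

(** About [x] only continuity at 0 and the derivative of [F (x t)] there are assumed, so the rule
    can be iterated. The increment factors as [s t * k t]; by the mean value theorem [k t] is a
    value of [dirD F v] at a point close to [x 0], and continuity of [dirD F v] does the rest. *)
Lemma is_derive_step F (x : R -> Mx * Mx) v (s : R -> R) (d ds : R) :
  smooth F -> pecvg (nbhs 0) x (x 0) -> GLset (x 0) -> s 0 = 0 ->
  is_derive (0 : R) 1 s ds -> is_derive (0 : R) 1 (fun t => F (x t)) d ->
  is_derive (0 : R) 1 (fun t => F (pshift (x t) v (s t))) (d + ds * dirD F v (x 0)).
Proof.
move=> sF xx Gx s0 sd dx.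
have [g [gE gc g0]] := (is_derive1_caratheodory s 0 ds).1 sd.
(* Where [s t = 0] the increment vanishes and any value of [k] would satisfy the factorisation; this
   one makes [k] continuous at 0. *)
pose k t := if s t == 0 then dirD F v (x 0) else
  (F (pshift (x t) v (s t)) - F (x t)) / s t.
have kE t : F (pshift (x t) v (s t)) - F (x t) = s t * k t.
  rewrite /k; have [->|st0] := eqVneq (s t) 0; first by rewrite pshift0 subrr mul0r.
  by rewrite mulrC divfK.
have sc : s t @[t --> 0] --> 0.
  have -> : s = fun t => g t * t by apply/funext => t; have := gE t; rewrite s0 !subr0.
  by rewrite -[X in _ --> X](mulr0 (g 0)); apply: cvgM => //; exact: cvg_id.
have kc : {for 0, continuous k}.
  move=> A; rewrite {1}/k s0 eqxx => Ad.
  have [e1 e10 H1] := near_pshift v xx (nbhs_GLset Gx).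
  have [e2 e20 H2] := near_pshift v xx (@smooth_continuous F v _ sF Gx A Ad).
  have H3 : \forall t \near (0 : R), `|s t| < e1.
    by move/cvgr_norm_lt : sc; apply; rewrite normr0.
  have H4 : \forall t \near (0 : R), `|s t| < e2.
    by move/cvgr_norm_lt : sc; apply; rewrite normr0.
  suff : \forall t \near (0 : R), A (k t) by [].
  near=> t; have [st0|st0] := eqVneq (s t) 0.
    by rewrite /k st0 eqxx; exact: nbhs_singleton Ad.
  rewrite /k (negbTE st0).
  have h1 : forall u, `|u| < e1 -> GLset (pshift (x t) v u) by near: t; exact: H1.
  have h2 : forall u, `|u| < e2 -> A (dirD F v (pshift (x t) v u)) by near: t; exact: H2.
  have h3 : `|s t| < e1 by near: t; exact: H3.
  have h4 : `|s t| < e2 by near: t; exact: H4.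
  have [u us|u us ->] := @smooth_mean_value F v (x t) (s t) sF.
    exact/h1/(le_lt_trans us).
  by rewrite mulrC mulKf //; apply/h2/(le_lt_trans us).
have dk : is_derive (0 : R) 1 (fun t => s t * k t) (ds * k 0).
  (* Caratheodory's form: [s t = g t * t] with [g] continuous at 0 and [g 0 = ds], so the product
     has slope function [g t * k t]. *)
  apply: (is_derive1_caratheodory _ _ _).2; exists (fun t => g t * k t); split.
  - move=> t; rewrite s0 mul0r !subr0 mulrAC; congr (_ * _).
    by have := gE t; rewrite s0 !subr0.
  - exact: cvgM.
  - by rewrite g0.
have k0 : k 0 = dirD F v (x 0) by rewrite /k s0 eqxx.
rewrite k0 in dk.
rewrite (_ : (fun t => F (pshift _ _ _)) = (fun t => F (x t)) + (fun t => s t * k t)).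
  exact: is_deriveD dx dk.
by apply/funext => t; rewrite -[RHS]/(F (x t) + s t * k t) -kE addrC subrK.
Unshelve. all: by end_near. Qed.

End Step.

(** * Derivatives at 0 of complex and matrix-valued curves *)

Section ComplexDerivative.
Variable R : realType.

Definition cderiv (z : R -> R[i]) (dz : R[i]) : Prop :=
  is_derive (0 : R) 1 (fun t => complex.Re (z t)) (complex.Re dz) /\
  is_derive (0 : R) 1 (fun t => complex.Im (z t)) (complex.Im dz).

Lemma is_derive_ext (f g : R -> R) (x d e : R) :
  is_derive x 1 f d -> f =1 g -> d = e -> is_derive x 1 g e.
Proof. by move=> fd /funext <- <-. Qed.

Lemma cderiv_ext z w (dz dw : R[i]) : cderiv z dz -> z =1 w -> dz = dw -> cderiv w dw.
Proof. by move=> zd /funext <- <-. Qed.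

Lemma cderiv_cst (z : R[i]) : cderiv (fun=> z) 0.
Proof. by split; exact: is_derive_cst. Qed.

Lemma cderiv_rc (s : R -> R) ds : is_derive (0 : R) 1 s ds ->
  cderiv (fun t => rc (s t)) (rc ds).
Proof. by move=> sd; split=> //=; exact: is_derive_cst. Qed.

Lemma cderivD z w (dz dw : R[i]) : cderiv z dz -> cderiv w dw ->
  cderiv (fun t => z t + w t) (dz + dw).
Proof.
move=> [zr zi] [wr wi]; split.
  apply: (is_derive_ext (is_deriveD zr wr)) => [t|]; last by rewrite raddfD.
  by rewrite raddfD.
apply: (is_derive_ext (is_deriveD zi wi)) => [t|]; last by rewrite raddfD.
by rewrite raddfD.
Qed.

Lemma ReD (z w : R[i]) : complex.Re (z + w) = complex.Re z + complex.Re w.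
Proof. by case: z w => a b [c d]. Qed.

Lemma ImD (z w : R[i]) : complex.Im (z + w) = complex.Im z + complex.Im w.
Proof. by case: z w => a b [c d]. Qed.

Lemma ReM (z w : R[i]) : complex.Re (z * w) =
  complex.Re z * complex.Re w - complex.Im z * complex.Im w.
Proof. by case: z w => a b [c d]. Qed.

Lemma ImM (z w : R[i]) : complex.Im (z * w) =
  complex.Re z * complex.Im w + complex.Im z * complex.Re w.
Proof. by case: z w => a b [c d]. Qed.

Lemma cderivM z w (dz dw : R[i]) : cderiv z dz -> cderiv w dw ->
  cderiv (fun t => z t * w t) (dz * w 0 + z 0 * dw).
Proof.
move=> [zr zi] [wr wi]; split.
  apply: (is_derive_ext (is_deriveB (is_deriveM zr wr) (is_deriveM zi wi))) => [t|].
    exact: (esym (ReM _ _)).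
  by rewrite ReD !ReM /GRing.scale /=; ring.
apply: (is_derive_ext (is_deriveD (is_deriveM zr wi) (is_deriveM zi wr))) => [t|].
  exact: (esym (ImM _ _)).
by rewrite ImD !ImM /GRing.scale /=; ring.
Qed.

Lemma cderiv_sum (I : Type) (r : seq I) (z : I -> R -> R[i]) (dz : I -> R[i]) :
  (forall k, cderiv (z k) (dz k)) ->
  cderiv (fun t => \sum_(k <- r) z k t) (\sum_(k <- r) dz k).
Proof.
move=> zd; elim: r => [|k r IH].
  by apply: (cderiv_ext (cderiv_cst 0)) => [t|]; rewrite big_nil.
by apply: (cderiv_ext (cderivD (zd k) IH)) => [t|]; rewrite big_cons.
Qed.

Definition mderiv m n (c : R -> 'M[R[i]]_(m, n)) (V : 'M[R[i]]_(m, n)) : Prop :=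
  forall i j, cderiv (fun t => c t i j) (V i j).

Lemma mderiv_ext m n (c e : R -> 'M[R[i]]_(m, n)) V W :
  mderiv c V -> c =1 e -> V = W -> mderiv e W.
Proof. by move=> cV /funext <- <-. Qed.

Lemma mderiv_cst m n (A : 'M[R[i]]_(m, n)) : mderiv (fun=> A) 0.
Proof. by move=> i j; rewrite mxE; exact: cderiv_cst. Qed.

Lemma mderivD m n (c e : R -> 'M[R[i]]_(m, n)) V W :
  mderiv c V -> mderiv e W -> mderiv (fun t => c t + e t) (V + W).
Proof.
move=> cV eW i j.
by apply: (cderiv_ext (cderivD (cV i j) (eW i j))) => [t|]; rewrite mxE.
Qed.

Lemma mderivZ m n (z : R -> R[i]) dz (A : 'M[R[i]]_(m, n)) :
  cderiv z dz -> mderiv (fun t => z t *: A) (dz *: A).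
Proof.
move=> zd i j; apply: (cderiv_ext (cderivM zd (cderiv_cst (A i j)))) => [t|].
  by rewrite mxE.
by rewrite mulr0 addr0 mxE.
Qed.

Lemma mderivM m n p (c : R -> 'M[R[i]]_(m, n)) (e : R -> 'M[R[i]]_(n, p)) V W :
  mderiv c V -> mderiv e W -> mderiv (fun t => c t *m e t) (V *m e 0 + c 0 *m W).
Proof.
move=> cV eW i j.
apply: (cderiv_ext (cderiv_sum _ (fun k => cderivM (cV i k) (eW k j)))) => [t|].
  by rewrite mxE.
by rewrite !mxE big_split.
Qed.

Lemma mderivMl m n p (A : 'M[R[i]]_(m, n)) (e : R -> 'M[R[i]]_(n, p)) W :
  mderiv e W -> mderiv (fun t => A *m e t) (A *m W).
Proof.
by move=> eW; apply: (mderiv_ext (mderivM (mderiv_cst A) eW)) => //; rewrite mul0mx add0r.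
Qed.

Lemma mderivMr m n p (c : R -> 'M[R[i]]_(m, n)) (A : 'M[R[i]]_(n, p)) V :
  mderiv c V -> mderiv (fun t => c t *m A) (V *m A).
Proof.
by move=> cV; apply: (mderiv_ext (mderivM cV (mderiv_cst A))) => //; rewrite mulmx0 addr0.
Qed.

Lemma mderiv_line m n (A X : 'M[R[i]]_(m, n)) : mderiv (fun t => A + rc t *: X) X.
Proof.
apply: (mderiv_ext (mderivD (mderiv_cst A) (mderivZ X (cderiv_rc (is_derive_id _ _))))) => //.
by rewrite add0r /rc scale1r.
Qed.

Lemma is_derive_continuous (f : R -> R) (x d : R) : is_derive x 1 f d -> f t @[t --> x] --> f x.
Proof. by move=> [fd _]; apply: differentiable_continuous; exact/derivable1_diffP. Qed.

End ComplexDerivative.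

(** * Shifts along a list of directions, and the real coordinates of a matrix *)

Section ChainRule.
Variables (R : realType) (n : nat).
Local Notation Mx := 'M[R[i]]_n.
Implicit Types (F : Mx * Mx -> R) (x v : Mx * Mx).

(** Each shift starts from the curve already shifted, hence the base point and the convergence are
    carried through the induction. All [s k] vanish at 0, so every directional derivative is taken
    at the same [x0]. *)
Lemma is_derive_pshift_seq F (I : eqType) (r : seq I) (x : R -> Mx * Mx) x0
    (V : I -> Mx * Mx) (s : I -> R -> R) (ds : I -> R) (d : R) :
  smooth F -> x 0 = x0 -> pecvg (nbhs 0) x x0 -> GLset x0 ->
  (forall k, s k 0 = 0) -> (forall k, is_derive (0 : R) 1 (s k) (ds k)) ->
  is_derive (0 : R) 1 (fun t => F (x t)) d ->
  let y t := foldr (fun k y => pshift y (V k) (s k t)) (x t) r in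
  [/\ y 0 = x0, pecvg (nbhs 0) y x0 &
  is_derive (0 : R) 1 (fun t => F (y t)) (d + \sum_(k <- r) ds k * dirD F (V k) x0)].
Proof.
move=> sF <- xx Gx s0 sd dx; elim: r => [|k r [IH0 IH1 IH2]] /=.
  by split=> //; rewrite big_nil addr0.
set y := fun t => foldr _ _ _ in IH1 IH0 IH2.
have yy : pecvg (nbhs 0) y (y 0) by rewrite /y IH0.
have Gy : GLset (y 0) by rewrite /y IH0.
split.
- by rewrite s0 pshift0.
- apply: (@pecvg_shift _ _ _ _ _ y (x 0) (V k) (s k) IH1).
  by rewrite -[X in _ --> X](s0 k); exact: is_derive_continuous (sd k).
- apply: (is_derive_ext (is_derive_step (V k) sF yy Gy (s0 k) (sd k) IH2)) => //.
  by rewrite big_cons /y IH0 -addrA; congr (_ + _); rewrite addrC.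
Qed.

Lemma foldr_pshift (I : Type) (r : seq I) (x : Mx * Mx) (V : I -> Mx * Mx) (s : I -> R) :
  foldr (fun k y => pshift y (V k) (s k)) x r =
  (x.1 + \sum_(k <- r) rc (s k) *: (V k).1, x.2 + \sum_(k <- r) rc (s k) *: (V k).2).
Proof.
elim: r => [|k r /= ->]; first by rewrite !big_nil !addr0; case: x.
by rewrite /pshift /= !big_cons -!addrA; congr (_, _); congr (_ + _); rewrite addrC.
Qed.

Lemma mx_delta_ReIm (A : Mx) :
  A = \sum_(k : 'I_n * 'I_n) rc (complex.Re (A k.1 k.2)) *: delta_mx k.1 k.2 +
      \sum_(k : 'I_n * 'I_n) rc (complex.Im (A k.1 k.2)) *: ('i *: delta_mx k.1 k.2).
Proof.
rewrite -big_split /= {1}[A]matrix_sum_delta pair_bigA /=; apply: eq_bigr => k _.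
by rewrite scalerA -scalerDl {1}[A k.1 k.2]complexE mulrC.
Qed.

End ChainRule.

(** * The chain rule in terms of gradients for the trace form *)

Section MatrixChainRule.
Variables (R : realType) (n : nat).
Local Notation Mx := 'M[R[i]]_n.
Implicit Types (F : Mx * Mx -> R) (x v : Mx * Mx) (X Y Z : Mx).

Lemma Re_sum (I : Type) (r : seq I) (P : pred I) (z : I -> R[i]) :
  complex.Re (\sum_(k <- r | P k) z k) = \sum_(k <- r | P k) complex.Re (z k).
Proof. exact: raddf_sum. Qed.

Lemma ipE X Y : ip X Y = \sum_i \sum_j complex.Re (X i j * Y j i).
Proof.
rewrite /ip /mxtrace Re_sum; apply: eq_bigr => i _.
by rewrite mxE Re_sum.
Qed.

(** [grad] reads [L] only on a real basis; pairing with it is the real-linear map that agrees with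
    [L] on this basis. This is the shape in which the sums of directional derivatives arrive. *)
Lemma ip_grad (L : Mx -> R) X : ip (grad L) X =
  \sum_(k : 'I_n * 'I_n) complex.Re (X k.1 k.2) * L (delta_mx k.1 k.2) +
  \sum_(k : 'I_n * 'I_n) complex.Im (X k.1 k.2) * L ('i *: delta_mx k.1 k.2).
Proof.
rewrite ipE -big_split /= -(pair_bigA _ (fun i j => complex.Re (X i j) * L (delta_mx i j) +
  complex.Im (X i j) * L ('i *: delta_mx i j))) exchange_big /=.
apply: eq_bigr => i _; apply: eq_bigr => j _; rewrite mxE.
by case: (X _ _) => a b; rewrite /rc /=; ring.
Qed.

Definition gradD1 F x := grad (fun X => dirD F (X, 0) x).
Definition gradD2 F x := grad (fun X => dirD F (0, X) x).

Lemma chain_rule F (c e : R -> Mx) (V W g J : Mx) :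
  smooth F -> g \in unitmx -> c 0 = g -> e 0 = J -> mderiv c V -> mderiv e W ->
  is_derive (0 : R) 1 (fun t => F (c t, e t))
    (ip (gradD1 F (g, J)) V + ip (gradD2 F (g, J)) W).
Proof.
move=> sF + cg eJ; rewrite -cg -eJ => gu cV eW; set x0 := (c 0, e 0).
have Gx0 : GLset x0 by [].
pose re (b : R -> Mx) (k : 'I_n * 'I_n) t := complex.Re ((b t - b 0) k.1 k.2).
pose im (b : R -> Mx) (k : 'I_n * 'I_n) t := complex.Im ((b t - b 0) k.1 k.2).
have re0 b k : re b k 0 = 0 by rewrite /re subrr mxE.
have im0 b k : im b k 0 = 0 by rewrite /im subrr mxE.
have bB b B : mderiv b B -> mderiv (fun t => b t - b 0) B.
  move=> bB; apply: (mderiv_ext (mderivD bB (mderiv_cst (- b 0)))) => //.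
  by rewrite addr0.
have red b B k : mderiv b B -> is_derive (0 : R) 1 (re b k) (complex.Re (B k.1 k.2)).
  by move=> /bB /(_ k.1 k.2)[].
have imd b B k : mderiv b B -> is_derive (0 : R) 1 (im b k) (complex.Im (B k.1 k.2)).
  by move=> /bB /(_ k.1 k.2)[].
(* The constant curve at [x0] is deformed into [(c, e)] in four rounds: real and imaginary
   coordinates of [c t - c 0], then those of [e t - e 0]. *)
have xc : pecvg (nbhs (0 : R)) (fun=> x0) x0 by split=> i j; split; exact: cvg_cst.
have dx0 : is_derive (0 : R) 1 (fun=> F x0) 0 by exact: is_derive_cst.
have [e1 p1 d1] := is_derive_pshift_seq (index_enum _)
  (fun k : 'I_n * 'I_n => (delta_mx k.1 k.2, 0)) sF (erefl x0) xc Gx0 (re0 c)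
  (fun k => red c V k cV) dx0.
have [e2 p2 d2] := is_derive_pshift_seq (index_enum _)
  (fun k : 'I_n * 'I_n => ('i *: delta_mx k.1 k.2, 0)) sF e1 p1 Gx0 (im0 c)
  (fun k => imd c V k cV) d1.
have [e3 p3 d3] := is_derive_pshift_seq (index_enum _)
  (fun k : 'I_n * 'I_n => (0, delta_mx k.1 k.2)) sF e2 p2 Gx0 (re0 e)
  (fun k => red e W k eW) d2.
have [e4 p4 d4] := is_derive_pshift_seq (index_enum _)
  (fun k : 'I_n * 'I_n => (0, 'i *: delta_mx k.1 k.2)) sF e3 p3 Gx0 (im0 e)
  (fun k => imd e W k eW) d3.
apply: (is_derive_ext d4) => [t|].
  rewrite !foldr_pshift /=; congr F; congr (_, _).
    have e0 (s : 'I_n * 'I_n -> R) : \sum_k rc (s k) *: (0 : Mx) = 0.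
      by rewrite big1 // => k _; rewrite scaler0.
    by rewrite !e0 !addr0 -addrA -mx_delta_ReIm addrC subrK.
  have e0 (s : 'I_n * 'I_n -> R) : \sum_k rc (s k) *: (0 : Mx) = 0.
    by rewrite big1 // => k _; rewrite scaler0.
  by rewrite !e0 !addr0 -addrA -mx_delta_ReIm addrC subrK.
rewrite add0r -2!addrA addrA; congr (_ + _); symmetry.
  exact: (ip_grad (fun X => dirD F (X, 0) x0) V).
exact: (ip_grad (fun X => dirD F (0, X) x0) W).
Qed.

End MatrixChainRule.

(** * Closed forms of the exponential on square-zero and idempotent matrices *)

Section MatrixExponential.
Variables (R : realType) (n : nat).
Local Notation Mx := 'M[R[i]]_n.
Implicit Types (X : Mx).

Lemma mexp_lim X (L : Mx) :
  ecvg \oo (fun N : nat => \sum_(k < N) rc (k`!%:R)^-1 *: X ^+ k) L -> mexp X = L.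
Proof. by move=> XL; apply: (cvg_lim (@mxC_hausdorff R n n)); exact: ecvg_cvg. Qed.

Lemma mexp_nilpotent X : X * X = 0 -> mexp X = 1 + X.
Proof.
move=> XX; apply: mexp_lim.
have E : \forall N \near \oo, \sum_(k < N) rc (k`!%:R)^-1 *: X ^+ k = 1 + X.
  exists 2%N => // N /= N2; rewrite -(subnK N2) addn2 2!big_ord_recl big1.
    by rewrite /= !fact0 invr1 /rc !scale1r expr0 expr1 addr0.
  by move=> i _; rewrite /= /bump /= !add1n 2!exprS mulrA XX mul0r scaler0.
by move=> i j; split; apply: cvg_near_cst; apply: filterS E => N ->.
Qed.

Lemma mexp0 : mexp (0 : Mx) = 1.
Proof. by rewrite mexp_nilpotent ?mul0r ?addr0. Qed.

Lemma mx_exprZ (w : R[i]) X k : (w *: X) ^+ k = w ^+ k *: X ^+ k.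
Proof.
elim: k => [|k IH]; first by rewrite !expr0 scale1r.
by rewrite !exprS IH -[LHS]/(_ *m _) -scalemxAl -scalemxAr scalerA.
Qed.

(** All positive powers of [E] equal [E], so the series is the scalar exponential series times [E],
    and [1 - E] corrects the term of exponent 0. The scalar limit [z] is a parameter so that real
    and imaginary exponents share the argument. *)
Lemma mexp_idempotent (E : Mx) (w z : R[i]) : E * E = E ->
  complex.Re (\sum_(k < N) rc (k`!%:R)^-1 * w ^+ k) @[N --> \oo] --> complex.Re z ->
  complex.Im (\sum_(k < N) rc (k`!%:R)^-1 * w ^+ k) @[N --> \oo] --> complex.Im z ->
  mexp (w *: E) = 1 - E + z *: E.
Proof.
move=> EE zr zi; apply: mexp_lim.
pose S N : R[i] := \sum_(k < N) rc (k`!%:R)^-1 * w ^+ k.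
have Ek k : E ^+ k.+1 = E by elim: k => [|k IH]; rewrite ?expr1 // exprS IH EE.
have SE : \forall N \near \oo,
    \sum_(k < N) rc (k`!%:R)^-1 *: (w *: E) ^+ k = 1 - E + S N *: E.
  exists 1%N => // -[|N] // _; rewrite /S !big_ord_recl /= fact0 invr1 /rc scale1r mul1r.
  rewrite !expr0 scalerDl scale1r addrA subrK; congr (_ + _); rewrite scaler_suml.
  by apply: eq_bigr => k _; rewrite mx_exprZ Ek scalerA.
move=> i j; split.
  suff H : complex.Re ((1 - E + S N *: E) i j) @[N --> \oo] -->
      complex.Re ((1 - E + z *: E) i j).
    by apply: cvg_trans H; apply: near_eq_cvg; apply: filterS SE => N ->.
  rewrite mxE ReD [(_ *: E) i j]mxE ReM; under eq_fun do rewrite mxE ReD [(_ *: E) i j]mxE ReM.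
  apply: cvgD; first exact: cvg_cst.
  by apply: cvgB; apply: cvgM => //; exact: cvg_cst.
suff H : complex.Im ((1 - E + S N *: E) i j) @[N --> \oo] -->
    complex.Im ((1 - E + z *: E) i j).
  by apply: cvg_trans H; apply: near_eq_cvg; apply: filterS SE => N ->.
rewrite mxE ImD [(_ *: E) i j]mxE ImM; under eq_fun do rewrite mxE ImD [(_ *: E) i j]mxE ImM.
apply: cvgD; first exact: cvg_cst.
by apply: cvgD; apply: cvgM => //; exact: cvg_cst.
Qed.

Lemma mexp_real_idempotent (E : Mx) (t : R) : E * E = E ->
  mexp (rc t *: E) = 1 - E + rc (expR t) *: E.
Proof.
move=> EE.
have S N : \sum_(k < N) rc (k`!%:R)^-1 * rc t ^+ k = rc (series (exp_coeff t) N).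
  rewrite /series /= big_mkord /rc rmorph_sum; apply: eq_bigr => k _.
  by rewrite /exp_coeff /= rmorphM rmorphXn mulrC.
apply: mexp_idempotent => //; under eq_fun do rewrite S /=.
  exact: is_cvg_series_exp_coeff.
exact: cvg_cst.
Qed.

Lemma mexp_imaginary_idempotent (E : Mx) (t : R) : E * E = E ->
  mexp (('i * rc t) *: E) = 1 - E + (rc (cos t) + 'i * rc (sin t)) *: E.
Proof.
move=> EE.
(* The sine coefficients are written with the exponent [k.-1./2], whereas splitting ['i ^+ k] by
   parity produces [k./2]. *)
have half_pred m : odd m -> m.-1./2 = m./2.
  by case: m => // m /= mo; rewrite -[RHS]/(uphalf m) uphalf_half (negbTE mo).
have S N : \sum_(k < N) rc (k`!%:R)^-1 * ('i * rc t) ^+ k =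
    rc (series (cos_coeff t) N) + 'i * rc (series (sin_coeff t) N).
  rewrite /series /= !big_mkord /rc !rmorph_sum mulr_sumr -big_split /=.
  apply: eq_bigr => k _; rewrite /cos_coeff /sin_coeff /= exprMn.
  rewrite -[X in 'i ^+ X](odd_double_half k) -muln2 mulnC exprD exprM sqrCi.
  have [ko|ke] := boolP (odd k).
    have k2 : k.-1./2 = k./2 by rewrite half_pred.
    rewrite !mul0r k2 /= !(rmorphM, rmorphXn, rmorphN, rmorph1, rmorph0) /=.
    by ring.
  rewrite !mul0r /= -exprnP !(rmorphM, rmorphXn, rmorphN, rmorph1, rmorph0) /=.
  by ring.
have Hs : complex.Im (rc (cos t) + 'i * rc (sin t)) = sin t.
  by rewrite ImD ImM /= !(mul0r, mulr0, mul1r, add0r, addr0).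
apply: (@mexp_idempotent E ('i * rc t) (rc (cos t) + 'i * rc (sin t)) EE);
  under eq_fun do rewrite S.
  under eq_fun do rewrite ReD ReM /= !(mul0r, mulr0, subr0, addr0).
  rewrite ReD ReM /= !(mul0r, mulr0, subr0, addr0) cos.unlock.
  exact: is_cvg_series_cos_coeff.
under eq_fun do rewrite ImD ImM /= !(mul0r, mulr0, mul1r, add0r, addr0).
rewrite Hs sin.unlock.
exact: is_cvg_series_sin_coeff.
Qed.

End MatrixExponential.

(** * The gradients of the bracket through the partial gradients of [F] *)

Section Gradients.
Variables (R : realType) (n : nat).
Local Notation Mx := 'M[R[i]]_n.
Implicit Types (F : Mx * Mx -> R) (X Y Z g J : Mx).

(** These are the only directions that [grad] evaluates. Off the diagonal the exponential is affine
    in [t]; on the diagonal it is given by [expR] for [z = 1] and by [cos] and [sin] for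
    [z = 'i]. *)
Lemma mderiv_mexp_delta (z : R[i]) (a b : 'I_n) : z = 1 \/ z = 'i ->
  mderiv (fun t => mexp (rc t *: (z *: delta_mx a b))) (z *: delta_mx a b : Mx).
Proof.
move=> hz; have [<-|ab] := eqVneq a b; last first.
  apply: (mderiv_ext (mderiv_line 1 (z *: delta_mx a b))) => // t.
  rewrite mexp_nilpotent // -[LHS]/(_ *m _) -!(scalemxAl, scalemxAr).
  by rewrite mul_delta_mx_0 1?eq_sym // !scaler0.
have EE : delta_mx a a * delta_mx a a = delta_mx a a :> Mx by exact: mul_delta_mx.
case: hz => ->.
  have e0 := is_derive_expR (0 : R); rewrite expR0 in e0.
  apply: (mderiv_ext (mderivD (mderiv_cst (1 - delta_mx a a))
    (mderivZ (delta_mx a a) (cderiv_rc e0)))) => [t|].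
    by rewrite scale1r mexp_real_idempotent.
  by rewrite add0r.
have c0 := is_derive_cos (0 : R); rewrite sin0 oppr0 in c0.
have s0 := is_derive_sin (0 : R); rewrite cos0 in s0.
have cs : cderiv (fun t : R => rc (cos t) + 'i * rc (sin t)) 'i.
  apply: (cderiv_ext (cderivD (cderiv_rc c0)
    (cderivM (cderiv_cst 'i) (cderiv_rc s0)))) => //.
  by rewrite /rc mul0r mulr1 !add0r.
apply: (mderiv_ext (mderivD (mderiv_cst (1 - delta_mx a a))
  (mderivZ (delta_mx a a) cs))) => [t|].
  by rewrite scalerA [rc t * 'i]mulrC mexp_imaginary_idempotent.
by rewrite add0r.
Qed.

Lemma ip_delta Y a b : ip Y (delta_mx b a) = complex.Re (Y a b).
Proof.
rewrite ipE (bigD1 a) //= [X in _ + X]big1 => [|i /negbTE ia]; last first.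
  by rewrite big1 // => j _; rewrite mxE ia andbF mulr0.
rewrite addr0 (bigD1 b) //= big1 => [|j /negbTE jb]; last by rewrite mxE jb mulr0.
by rewrite mxE !eqxx mulr1 addr0.
Qed.

Lemma ip_idelta Y a b : ip Y ('i *: delta_mx b a) = - complex.Im (Y a b).
Proof.
rewrite /ip -scalemxAr scalemxAl -[LHS]/(ip ('i *: Y) (delta_mx b a)) ip_delta mxE.
by case: (Y a b) => x y /=; rewrite mul0r mul1r sub0r.
Qed.

Lemma eq_grad (L : Mx -> R) Y :
  (forall z a b, z = 1 \/ z = 'i -> L (z *: delta_mx a b) = ip Y (z *: delta_mx a b)) ->
  grad L = Y.
Proof.
move=> LY; apply/matrixP => a b; rewrite mxE.
have := LY 1 b a (or_introl erefl); rewrite !scale1r ip_delta => ->.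
rewrite (LY 'i b a (or_intror erefl)) ip_idelta [RHS]complexE.
by rewrite /rc rmorphN mulrN opprK.
Qed.

Lemma is_derive_derive1 (f : R -> R) (x d : R) : is_derive x 1 f d -> derive1 f x = d.
Proof. by move=> fd; rewrite derive1E derive_val. Qed.

Lemma ip0r X : ip X 0 = 0.
Proof. by rewrite /ip mulmx0 linear0. Qed.

Lemma ip0l X : ip 0 X = 0.
Proof. by rewrite /ip mul0mx linear0. Qed.

Lemma ipC X Y : ip X Y = ip Y X.
Proof. by rewrite /ip mxtrace_mulC. Qed.

Lemma ipMl X Y Z : ip (X *m Y) Z = ip X (Y *m Z).
Proof. by rewrite /ip mulmxA. Qed.

Lemma ipMC X Y Z : ip X (Y *m Z) = ip (Z *m X) Y.
Proof. by rewrite ipC [RHS]ipC /ip -!mulmxA mxtrace_mulC -mulmxA. Qed.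

(** Cyclicity of the trace: <D, X g> = <g D, X>. With the mirror formula for [nabla1'] this yields
    [nabla1 F *m g = g *m nabla1' F]. *)
Lemma nabla1E F g J : smooth F -> g \in unitmx ->
  nabla1 F g J = g *m gradD1 F (g, J).
Proof.
move=> sF gu; apply: eq_grad => z a b hz; apply: is_derive_derive1.
have c0 : mexp (rc 0 *: (z *: delta_mx a b)) *m g = g.
  by rewrite /rc scale0r mexp0; exact: mul1mx.
have H := chain_rule sF gu c0 (erefl J) (mderivMr g (mderiv_mexp_delta a b hz)) (mderiv_cst J).
apply: (is_derive_ext H) => //.
by rewrite -[RHS]addr0; congr (_ + _); [exact: ipMC | exact: ip0r].
Qed.

Lemma nabla1'E F g J : smooth F -> g \in unitmx ->
  nabla1' F g J = gradD1 F (g, J) *m g.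
Proof.
move=> sF gu; apply: eq_grad => z a b hz; apply: is_derive_derive1.
have c0 : g *m mexp (rc 0 *: (z *: delta_mx a b)) = g.
  by rewrite /rc scale0r mexp0; exact: mulmx1.
have H := chain_rule sF gu c0 (erefl J) (mderivMl g (mderiv_mexp_delta a b hz)) (mderiv_cst J).
apply: (is_derive_ext H) => //.
by rewrite -[RHS]addr0; congr (_ + _); [exact: esym (ipMl _ _ _) | exact: ip0r].
Qed.

Lemma d2E F g J : smooth F -> g \in unitmx -> d2 F g J = gradD2 F (g, J).
Proof.
move=> sF gu; apply: eq_grad => z a b hz; apply: is_derive_derive1.
have e0 : J + rc 0 *: (z *: delta_mx a b) = J by rewrite /rc scale0r addr0.
have H := chain_rule sF gu (erefl g) e0 (mderiv_cst g) (mderiv_line J (z *: delta_mx a b)).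
apply: (is_derive_ext H) => //.
by rewrite -[RHS]add0r; congr (_ + _); exact: ip0r.
Qed.

End Gradients.

(** * Infinitesimal form of the two unitary invariances *)

Section Invariance.
Variables (R : realType) (n : nat).
Local Notation Mx := 'M[R[i]]_n.
Implicit Types (F : Mx * Mx -> R) (X Y Z A g J : Mx).

Lemma ipDl X Y Z : ip (X + Y) Z = ip X Z + ip Y Z.
Proof. by rewrite /ip mulmxDl linearD raddfD. Qed.

Lemma ipNl X Y : ip (- X) Y = - ip X Y.
Proof. by rewrite /ip mulNmx linearN raddfN. Qed.

Lemma ipBl X Y Z : ip (X - Y) Z = ip X Z - ip Y Z.
Proof. by rewrite ipDl ipNl. Qed.

Lemma ipDr X Y Z : ip X (Y + Z) = ip X Y + ip X Z.
Proof. by rewrite !(ipC X) ipDl. Qed.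

Lemma ipNr X Y : ip X (- Y) = - ip X Y.
Proof. by rewrite !(ipC X) ipNl. Qed.

Lemma ipBr X Y Z : ip X (Y - Z) = ip X Y - ip X Z.
Proof. by rewrite ipDr ipNr. Qed.

Lemma ipZl (s : R) X Y : ip (rc s *: X) Y = s * ip X Y.
Proof. by rewrite /ip -scalemxAl linearZ Re_rcM. Qed.

Lemma ipZr (s : R) X Y : ip X (rc s *: Y) = s * ip X Y.
Proof. by rewrite !(ipC X) ipZl. Qed.

Lemma adjD X Y : adj (X + Y) = adj X + adj Y.
Proof. by rewrite /adj linearD map_mxD. Qed.

Lemma adjN X : adj (- X) = - adj X.
Proof. by rewrite /adj linearN map_mxN. Qed.

Lemma adjZ (z : R[i]) X : adj (z *: X) = conjc z *: adj X.
Proof. by rewrite /adj linearZ map_mxZ. Qed.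

Lemma adjZr (s : R) X : adj (rc s *: X) = rc s *: adj X.
Proof. by rewrite adjZ /rc /= oppr0. Qed.

Lemma adjM X Y : adj (X *m Y) = adj Y *m adj X.
Proof. by rewrite /adj trmx_mul map_mxM. Qed.

Lemma adjK X : adj (adj X) = X.
Proof. by apply/matrixP => i j; rewrite !mxE conjcK. Qed.

Lemma adj1 : adj (1%:M : Mx) = 1%:M.
Proof. by rewrite /adj trmx1 map_mx1. Qed.

Lemma adj_delta i j : adj (delta_mx i j : Mx) = delta_mx j i.
Proof. by rewrite /adj trmx_delta map_delta_mx. Qed.

Lemma conjCi : conjc ('i : R[i]) = - 'i.
Proof. by apply/eqP; rewrite eq_complex /= oppr0 !eqxx. Qed.

(* The exponential of [t *: A], in closed form because [A ^ 3 = - A]. *)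
Definition ucurve A (t : R) : Mx := 1%:M + rc (sin t) *: A + rc (1 - cos t) *: (A *m A).

Lemma ucurve0 A : ucurve A 0 = 1%:M.
Proof. by rewrite /ucurve sin0 cos0 subrr /rc !scale0r !addr0. Qed.

Lemma mderiv_ucurve A : mderiv (ucurve A) A.
Proof.
have s0 := is_derive_sin (0 : R); rewrite cos0 in s0.
have c0 : is_derive (0 : R) 1 (fun t : R => 1 - cos t) 0.
  have c0 := is_derive_cos (0 : R); rewrite sin0 oppr0 in c0.
  have k0 : is_derive (0 : R) 1 (fun=> 1 : R) 0 by exact: is_derive_cst.
  apply: (is_derive_ext (is_deriveB k0 c0)) => //.
  by rewrite subr0.
apply: (mderiv_ext (mderivD (mderivD (mderiv_cst 1%:M) (mderivZ A (cderiv_rc s0)))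
  (mderivZ (A *m A) (cderiv_rc c0)))) => //.
by rewrite /rc scale0r scale1r add0r addr0.
Qed.

Lemma mderiv_ucurveN A : mderiv (fun t => ucurve A (- t)) (- A).
Proof.
apply: (mderiv_ext (mderiv_ucurve (- A))) => [t|]; last by [].
by rewrite /ucurve sinN cosN /rc rmorphN mulNmx mulmxN opprK scalerN scaleNr.
Qed.

Lemma adj_ucurve A t : adj A = - A -> adj (ucurve A t) = ucurve A (- t).
Proof.
move=> sA; rewrite /ucurve !adjD adj1 !adjZr adjM sA sinN cosN mulNmx mulmxN opprK.
by rewrite scalerN -scaleNr /rc rmorphN.
Qed.

(** Since [A^4 = - A^2], the product is 1 plus [A^2] times [2(1 - c) - s^2 - (1 - c)^2], which is
    [1 - s^2 - c^2 = 0]. *)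
Lemma ucurveM A t : A *m A *m A = - A -> ucurve A t *m ucurve A (- t) = 1%:M.
Proof.
move=> A3; rewrite /ucurve sinN cosN.
have A4 : A *m A *m (A *m A) = - (A *m A) by rewrite mulmxA A3 mulNmx.
have A3' : A *m (A *m A) = - A by rewrite mulmxA.
have rN : rc (- sin t) = - rc (sin t) :> R[i] by exact: rmorphN.
have rB : rc (1 - cos t) = 1 - rc (cos t) :> R[i] by exact: rmorphB.
have cs : rc (sin t) ^+ 2 = 1 - rc (cos t) ^+ 2 :> R[i].
  rewrite /rc -!rmorphXn -(rmorph1 (real_complex R)) -rmorphB; congr (_%:C).
  by rewrite -(cos2Dsin2 t) addrAC subrr add0r.
rewrite rN rB; move: (rc (sin t)) (rc (cos t)) cs => s c cs {rN rB}.
rewrite !(mulmxDl, mulmxDr) !mul1mx !mulmx1 -!(scalemxAl, scalemxAr) A4 A3 A3'.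
rewrite !scalerA; move: (A *m A) => B; apply/matrixP => i j; rewrite !mxE.
by ring: cs.
Qed.

Lemma unitary_ucurve A t : adj A = - A -> A *m A *m A = - A -> unitary (ucurve A t).
Proof. by move=> sA A3; rewrite /unitary adj_ucurve // ucurveM. Qed.

Lemma invmx_ucurve A t : A *m A *m A = - A -> invmx (ucurve A t) = ucurve A (- t).
Proof.
move=> A3; have uu := ucurveM t A3; have [ut _] := mulmx1_unit uu.
by rewrite -[LHS]mulmx1 -uu mulmxA mulVmx // mul1mx.
Qed.

Lemma is_derive_const0 (f : R -> R) (x d : R) : is_derive x 1 f d -> (forall t, f t = f x) -> d = 0.
Proof.
move=> fd fc; have f0 : is_derive x 1 (fun=> f x) 0 by exact: is_derive_cst.
have H := is_derive_ext f0 (fun t => esym (fc t)) erefl.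
by rewrite -(@derive_val _ _ _ _ _ _ _ fd) (@derive_val _ _ _ _ _ _ _ H).
Qed.

(** [F] is constant along [g u(t)^-1], where its derivative at 0 is minus this pairing. *)
Lemma nabla1'_skew F g J A : smooth F -> UUinvariant F -> g \in unitmx ->
  adj A = - A -> A *m A *m A = - A -> ip (nabla1' F g J) A = 0.
Proof.
move=> sF iF gu sA A3; rewrite nabla1'E //.
have c0 : g *m ucurve A (- 0) = g by rewrite oppr0 ucurve0 mulmx1.
have H := chain_rule sF gu c0 (erefl J) (mderivMl g (mderiv_ucurveN A)) (mderiv_cst J).
have := is_derive_const0 H.
move: (gradD1 _ _) (gradD2 _ _) => D1 D2.
rewrite ip0r addr0 mulmxN => E; apply/eqP; rewrite -oppr_eq0; apply/eqP.
apply: etrans (E _) => [|t].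
  by rewrite /ip -mulmxA mulmxN linearN raddfN.
rewrite c0 -(invmx_ucurve t A3).
by have [-> _] := iF _ (unitary_ucurve t sA A3) g J gu.
Qed.

(** The curve [(u g, u J u^-1)] has velocity [(A g, A J - J A)], and <d_2 F, A J - J A> = -
    <[d_2 F, J], A> by cyclicity of the trace. *)
Lemma nabla1_skew F g J A : smooth F -> UUinvariant F -> g \in unitmx ->
  adj A = - A -> A *m A *m A = - A ->
  ip (nabla1 F g J - comm (d2 F g J) J) A = 0.
Proof.
move=> sF iF gu sA A3; rewrite nabla1E // d2E //.
have c0 : ucurve A 0 *m g = g by rewrite ucurve0 mul1mx.
have e0 : ucurve A 0 *m J *m ucurve A (- 0) = J by rewrite oppr0 ucurve0 mul1mx mulmx1.
have H := chain_rule sF gu c0 e0 (mderivMr g (mderiv_ucurve A))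
  (mderivM (mderivMr J (mderiv_ucurve A)) (mderiv_ucurveN A)).
have := is_derive_const0 H.
move: (gradD1 _ _) (gradD2 _ _) => D1 D2 E.
apply: etrans (E _) => [|t].
  rewrite oppr0 ucurve0 mul1mx mulmx1 mulmxN ipBl ipBl ipBr ipMC ipMC -ipMl.
  by rewrite opprB.
rewrite c0 e0 -(invmx_ucurve t A3).
by have [_ ->] := iF _ (unitary_ucurve t sA A3) g J gu.
Qed.

(** The test matrices are [i E_aa], forcing real diagonal entries, and [w E_ab - conj(w) E_ba] with
    [w = 1] or [w = i], matching the real and imaginary parts of [Y_ab] and [conj(Y_ba)]. The latter
    square to [- E_aa - E_bb], whence [A^3 = - A]. *)
Lemma hermitian_of_skew Y :
  (forall A, adj A = - A -> A *m A *m A = - A -> ip Y A = 0) -> adj Y = Y.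
Proof.
have ii : 'i * 'i = -1 :> R[i] by rewrite -expr2 sqrCi.
move=> H; apply/matrixP => a b; rewrite !mxE; have [<-|ab] := eqVneq a b.
  have := H ('i *: delta_mx a a); rewrite adjZ adj_delta conjCi scaleNr ip_idelta.
  have -> : 'i *: delta_mx a a *m ('i *: delta_mx a a) = - delta_mx a a :> Mx.
    by rewrite -scalemxAl -scalemxAr scalerA ii mul_delta_mx scaleN1r.
  rewrite mulNmx -scalemxAr mul_delta_mx => /(_ erefl erefl)/eqP; rewrite oppr_eq0 => /eqP.
  by case: (Y a a) => x y /= ->; rewrite oppr0.
have ba : b != a by rewrite eq_sym.
have skew (w : R[i]) : w * conjc w = 1 ->
    ip Y (w *: delta_mx a b - conjc w *: delta_mx b a) = 0.
  move=> w1; have w1' : conjc w * w = 1 by rewrite mulrC.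
  apply: H; first by rewrite adjD adjN !adjZ !adj_delta conjcK opprB.
  have A2 : (w *: delta_mx a b - conjc w *: delta_mx b a) *m
      (w *: delta_mx a b - conjc w *: delta_mx b a) = - delta_mx a a - delta_mx b b :> Mx.
    rewrite !(mulmxBl, mulmxBr) -!(scalemxAl, scalemxAr) !mul_delta_mx_cond !eqxx.
    rewrite (negbTE ab) (negbTE ba) !mulr0n !mulr1n !scaler0 !(addr0, add0r, subr0, sub0r).
    by rewrite !scalerA w1 w1' !scale1r.
  rewrite A2 mulmxBr !(mulmxBl, mulNmx) -!scalemxAr !mul_delta_mx_cond !eqxx.
  rewrite (negbTE ab) (negbTE ba) !mulr0n !mulr1n !scaler0 !oppr0.
  by rewrite !(subr0, sub0r, opprK) addr0 opprB addrC.
have := skew 'i; rewrite conjCi mulrN ii opprK scaleNr opprK ipDr !ip_idelta => /(_ erefl).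
have := skew 1; rewrite conjc1 !scale1r mulr1 ipBr !ip_delta => /(_ erefl).
case: (Y a b) (Y b a) => x y [u v] /= h1 h2.
by apply/eqP; rewrite eq_complex /=; apply/andP; split; apply/eqP; lra.
Qed.

End Invariance.

(** * Trace form, Hermitian splitting and entrywise multipliers *)

Section BracketAlgebra.
Variables (R : realType) (n : nat).
Local Notation Mx := 'M[R[i]]_n.
Implicit Types (X Y Z a b J : Mx).

Lemma rc2V : rc (2^-1) + rc (2^-1) = 1 :> R[i].
Proof. by rewrite /rc -rmorphD -(rmorph1 (real_complex R)); congr (_%:C); lra. Qed.

Lemma pplusD X Y : pplus (X + Y) = pplus X + pplus Y.
Proof. by rewrite /pplus adjD opprD addrACA scalerDr. Qed.

Lemma pminusD X Y : pminus (X + Y) = pminus X + pminus Y.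
Proof. by rewrite /pminus adjD addrACA scalerDr. Qed.

Lemma pplusB X Y : pplus (X - Y) = pplus X - pplus Y.
Proof. by rewrite /pplus adjD adjN opprD addrACA -[- Y - - adj Y]opprD scalerBr. Qed.

Lemma pminusB X Y : pminus (X - Y) = pminus X - pminus Y.
Proof. by rewrite /pminus adjD adjN addrACA -opprD scalerBr. Qed.

Lemma pplus_pminus X : pplus X + pminus X = X.
Proof.
apply/matrixP => i j; rewrite !mxE; rewrite -[RHS]mul1r -rc2V.
by move: (rc _) (X i j) => h x; ring.
Qed.

Lemma pplus_hermitian X : adj X = X -> pplus X = 0.
Proof. by rewrite /pplus => ->; rewrite subrr scaler0. Qed.

Lemma ip_adj X Y : ip (adj X) (adj Y) = ip X Y.
Proof.
rewrite !ipE exchange_big; apply: eq_bigr => i _; apply: eq_bigr => j _.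
by rewrite !mxE; case: (X _ _) (Y _ _) => x x' [y y'] /=; rewrite mulrNN.
Qed.

(** [adj] is an isometric involution, and the two parts lie in its eigenspaces for -1 and 1. *)
Lemma ip_pplus_pminus X Y : ip (pplus X) (pminus Y) = 0.
Proof.
rewrite /pplus /pminus ipZl ipZr ipBl !ipDr -(ip_adj X Y) -(ip_adj X (adj Y)) adjK.
by rewrite [ip (adj X) (adj Y) + _]addrC subrr !mulr0.
Qed.

Lemma ip_pm X Y : ip X Y = ip (pplus X) (pplus Y) + ip (pminus X) (pminus Y).
Proof.
rewrite -{1}(pplus_pminus X) -{1}(pplus_pminus Y) ipDl !ipDr ip_pplus_pminus.
by rewrite (ipC (pminus X) (pplus Y)) ip_pplus_pminus addr0 add0r.
Qed.

(** Common form of [rmat] and [Rq]: real multipliers always commute, and antisymmetric coefficients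
    give antisymmetry for [ip], which pairs entry (i, j) with entry (j, i). *)
Definition schur (c : 'I_n -> 'I_n -> R) X : Mx := \matrix_(i, j) (X i j * rc (c i j)).

Lemma schurD c X Y : schur c (X + Y) = schur c X + schur c Y.
Proof. by apply/matrixP => i j; rewrite !mxE mulrDl. Qed.

Lemma schurN c X : schur c (- X) = - schur c X.
Proof. by apply/matrixP => i j; rewrite !mxE mulNr. Qed.

Lemma schurZ c z X : schur c (z *: X) = z *: schur c X.
Proof. by apply/matrixP => i j; rewrite !mxE mulrA. Qed.

Lemma schur_schur c d X : schur c (schur d X) = schur d (schur c X).
Proof. by apply/matrixP => i j; rewrite !mxE mulrAC. Qed.

Section Antisymmetric.
Variables (c : 'I_n -> 'I_n -> R) (cN : forall i j, c j i = - c i j).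

Lemma ip_schur X Y : ip (schur c X) Y = - ip X (schur c Y).
Proof.
rewrite !ipE -sumrN; apply: eq_bigr => i _; rewrite -sumrN; apply: eq_bigr => j _.
by rewrite !mxE (cN j i) /rc rmorphN mulrN mulNr mulrAC -mulrA; case: (_ * _).
Qed.

Lemma adj_schur X : adj (schur c X) = - schur c (adj X).
Proof.
apply/matrixP => i j; rewrite !mxE (cN i j); case: (X j i) => x y.
by apply/eqP; rewrite eq_complex /=; apply/andP; split; apply/eqP; ring.
Qed.

Lemma pplus_schur X : pplus (schur c X) = schur c (pminus X).
Proof. by rewrite /pplus /pminus adj_schur opprK schurZ schurD. Qed.

Lemma pminus_schur X : pminus (schur c X) = schur c (pplus X).
Proof. by rewrite /pplus /pminus adj_schur schurZ schurD schurN. Qed.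

End Antisymmetric.

Definition rcoef (i j : 'I_n) : R := 2^-1 * ((i < j)%N%:R - (j < i)%N%:R).

Lemma rcoefN i j : rcoef j i = - rcoef i j.
Proof. by rewrite /rcoef -mulrN opprB. Qed.

Lemma rmatE X : rmat X = schur rcoef X.
Proof.
apply/matrixP => i j; rewrite !mxE /rcoef /rc rmorphM rmorphB !rmorph_nat.
by case: ltngtP => _ /=; ring.
Qed.

Definition Rcoef (q : 'rV[R]_n) (i j : 'I_n) : R :=
  if i == j then 0 else coth (q 0 i - q 0 j).

Lemma cothN (x : R) : coth (- x) = - coth x.
Proof. by rewrite /coth opprK addrC -mulrN -invrN opprB. Qed.

Lemma RcoefN q i j : Rcoef q j i = - Rcoef q i j.
Proof. by rewrite /Rcoef eq_sym; case: eqP; rewrite ?oppr0 // -cothN opprB. Qed.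

Lemma RqE q X : Rq q X = schur (Rcoef q) X.
Proof.
apply/matrixP => i j; rewrite !mxE /Rcoef; case: eqP => // _.
by rewrite /rc rmorph0 mulr0.
Qed.

End BracketAlgebra.

(** * Bilinear algebra of the reduced bracket *)

Section ReducedBracketAlgebra.
Variables (R : realType) (n : nat).
Local Notation Mx := 'M[R[i]]_n.
Implicit Types (X Y Z a b J : Mx).

Definition offdiag0 (D : Mx) := forall i j, i != j -> D i j = 0.

Lemma ip_diag_dgp D X : offdiag0 D -> ip D (dgp X) = ip D X.
Proof.
move=> dD; rewrite !ipE; apply: eq_bigr => i _; apply: eq_bigr => j _.
by have [->|ij] := eqVneq i j; rewrite mxE ?eqxx // dD // !mul0r.
Qed.

Lemma ip_diag_rmat D X : offdiag0 D -> ip D (rmat X) = 0.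
Proof.
move=> dD; rewrite -ip_diag_dgp // /ip (_ : dgp _ = 0) ?mulmx0 ?linear0 //.
by apply/matrixP => i j; rewrite !mxE; case: eqP => // <-; rewrite ltnn subrr mulr0.
Qed.

Lemma rpm_sub X Y : rplus X - rminus Y = rmat (X - Y) + rc (2^-1) *: (X + Y).
Proof.
by rewrite /rplus /rminus !rmatE schurD schurN opprB [_ - schur _ Y]addrC addrACA scalerDr.
Qed.

Lemma ip_rmat X Y : ip (rmat X) Y = - ip X (rmat Y).
Proof. by rewrite !rmatE; apply: ip_schur; exact: rcoefN. Qed.

Lemma ip_Rq q X Y : ip (Rq q X) Y = - ip X (Rq q Y).
Proof. by rewrite !RqE; apply: ip_schur; exact: RcoefN. Qed.

Lemma Rq_rmat q X : Rq q (rmat X) = rmat (Rq q X).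
Proof. by rewrite !RqE !rmatE schur_schur. Qed.

(** Commutation and antisymmetry give <R X, r Y> = <r X, R Y>; [D] and [E] drop out because [r] has
    no diagonal part. It is applied with X = P^+, X' = P^-, Y = Q^+. *)
Lemma r_terms_cancel_aux q (D E X X' Y : Mx) : offdiag0 D -> offdiag0 E ->
  ip (D + Rq q X) (rmat Y) - ip X' (rmat Y) = ip Y (rmat X') + ip (E + Rq q Y) (rmat X).
Proof.
move=> dD dE; rewrite !ipDl (ip_diag_rmat _ dD) (ip_diag_rmat _ dE) !add0r.
rewrite (ip_Rq q X) Rq_rmat -(ip_rmat X) (ipC (rmat X)) (ipC Y) (ip_rmat X').
by rewrite addrC.
Qed.

Lemma bracket_zero_nabla1 (a a' b b' A A' B B' U : Mx) : b = 0 -> b' = 0 -> B = B' ->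
  ip (rmat a) b - ip (rmat a') b' + ip (A - A') (rplus B' - rminus B)
  + ip a (rplus B' - rminus B) - ip b U =
  ip (A - A') (rplus B - rminus B) + ip a (rplus B - rminus B).
Proof. by move=> -> -> <-; rewrite !ip0r ip0l subrr add0r subr0. Qed.

Section Bracket.
Variables (q : 'rV[R]_n) (J dF dH a b a' b' D E : Mx).
Local Notation P := (comm dF J).
Local Notation Q := (comm dH J).
Hypotheses (aP : adj (a - P) = a - P) (bQ : adj (b - Q) = b - Q).
Hypotheses (am : pminus a = D + Rq q (pplus P)) (bm : pminus b = E + Rq q (pplus Q)).
Hypotheses (dD : offdiag0 D) (dE : offdiag0 E).

Lemma pplus_of_hermitian_sub X Y : adj (X - Y) = X - Y -> pplus X = pplus Y.
Proof. by move/pplus_hermitian; rewrite pplusB => /eqP; rewrite subr_eq0 => /eqP. Qed.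

Lemma ip_hermitian_l X Y : adj X = X -> ip X Y = ip (pminus X) (pminus Y).
Proof. by move=> hX; rewrite ip_pm pplus_hermitian // ip0l add0r. Qed.

(* The terms of the bracket that involve [r] after the [nabla1, nabla1'] pair
   has cancelled: they vanish because [r] and [R q] commute and are
   antisymmetric. *)
Lemma r_terms_cancel : ip (a - P) (rmat Q) = ip b (rmat P).
Proof.
have rN := @rcoefN R n.
rewrite ip_hermitian_l // pminusB ipBl [RHS]ip_pm (pplus_of_hermitian_sub bQ).
rewrite (rmatE Q) (rmatE P) (pminus_schur rN) (pminus_schur rN) (pplus_schur rN) -!rmatE am bm.
exact: r_terms_cancel_aux.
Qed.

(** [k] is the [r] term, which occurs twice and cancels. The [m] and [p] are pairings of Hermitian
    and of anti-Hermitian parts, numbered 1: (dF J, J dH), 2: (J dF, J dH), 3: (dF J, dH J), 4: (J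
    dF, dH J). The hypothesis, from [ip_symplectic], eliminates numbers 2 and 3. *)
Lemma bracket_bookkeeping (k d p e s m1 m2 m3 m4 p1 p2 p3 p4 : R) :
  p2 + m2 = p3 + m3 ->
  2 * (k + 2^-1 * (d + p - (m1 + m3 - (m2 + m4))) -
       (k + 2^-1 * (e + s + (p4 - p2 + (p3 - p1))))) =
  d - e + p - s + m4 + p1 - m1 - p4.
Proof. by move=> h; lra. Qed.

Lemma ip_symplectic : ip (J *m dF) (J *m dH) = ip (dF *m J) (dH *m J).
Proof. by rewrite [RHS]ipMC !ipMl mulmxA. Qed.

Lemma bracket_reduced :
  ip (rmat a) b = ip (rmat a') b' ->
  2 * (ip (rmat a) b - ip (rmat a') b'
    + ip (J *m dF - dF *m J) (rplus (dH *m J) - rminus (J *m dH))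
    + ip a (rplus (dH *m J) - rminus (J *m dH))
    - ip b (rplus (dF *m J) - rminus (J *m dF))) =
  ip D (pminus0 (J *m dH + dH *m J)) - ip E (pminus0 (J *m dF + dF *m J))
  + ip (Rq q (pplus P)) (pminus (J *m dH + dH *m J))
  - ip (Rq q (pplus Q)) (pminus (J *m dF + dF *m J))
  + ip (pminus (J *m dF)) (pminus (dH *m J))
  + ip (pplus (dF *m J)) (pplus (J *m dH))
  - ip (pminus (dF *m J)) (pminus (J *m dH))
  - ip (pplus (J *m dF)) (pplus (dH *m J)).
Proof.
move=> ->; rewrite subrr add0r !rpm_sub.
have rc1 := r_terms_cancel.
have hH : ip (a - P) (J *m dH + dH *m J) =
    ip D (pminus (J *m dH + dH *m J)) + ip (Rq q (pplus P)) (pminus (J *m dH + dH *m J))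
    - ip (pminus P) (pminus (J *m dH + dH *m J)).
  by rewrite (ip_hermitian_l _ aP) pminusB am ipBl ipDl.
have hF : ip b (J *m dF + dF *m J) =
    ip E (pminus (J *m dF + dF *m J)) + ip (Rq q (pplus Q)) (pminus (J *m dF + dF *m J))
    + ip (pplus Q) (pplus (J *m dF + dF *m J)).
  by rewrite ip_pm (pplus_of_hermitian_sub bQ) bm ipDl addrC.
have hs := ip_symplectic.
rewrite (ip_pm (J *m dF)) (ip_pm (dF *m J)) in hs.
have eP : ip (pminus P) (pminus (J *m dH + dH *m J)) =
    ip (pminus (dF *m J)) (pminus (J *m dH)) + ip (pminus (dF *m J)) (pminus (dH *m J))
    - (ip (pminus (J *m dF)) (pminus (J *m dH)) + ip (pminus (J *m dF)) (pminus (dH *m J))).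
  by rewrite pminusB pminusD ipBl !ipDr.
have eQ : ip (pplus Q) (pplus (J *m dF + dF *m J)) =
    ip (pplus (J *m dF)) (pplus (dH *m J)) - ip (pplus (J *m dF)) (pplus (J *m dH))
    + (ip (pplus (dF *m J)) (pplus (dH *m J)) - ip (pplus (dF *m J)) (pplus (J *m dH))).
  by rewrite (ipC (pplus Q)) pplusB pplusD ipDl !ipBr.
(* [J *m dF - dF *m J] is [- P], so both terms merge into a pairing with the Hermitian matrix
   [a - P]. *)
have kH : ip (J *m dF - dF *m J) (rmat Q + rc 2^-1 *: (J *m dH + dH *m J)) +
   ip a (rmat Q + rc 2^-1 *: (J *m dH + dH *m J)) =
   ip (a - P) (rmat Q) + 2^-1 * ip (a - P) (J *m dH + dH *m J).
  by rewrite -ipDl addrC -[J *m dF - _]opprB ipDr ipZr.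
have kF : ip b (rmat P + rc 2^-1 *: (J *m dF + dF *m J)) =
   ip b (rmat P) + 2^-1 * ip b (J *m dF + dF *m J) by rewrite ipDr ipZr.
rewrite (addrC (dH *m J) (J *m dH)) (addrC (dF *m J) (J *m dF)).
rewrite -[dH *m J - J *m dH]/Q -[dF *m J - J *m dF]/P kH kF rc1 hH hF eP eQ.
rewrite /pminus0 (ip_diag_dgp _ dD) (ip_diag_dgp _ dE).
exact: bracket_bookkeeping hs.
Qed.

Lemma ip_commutator X Y W : Y *m W = W *m Y -> ip (comm X Y) W = 0.
Proof.
move=> YW; rewrite /comm ipBl ipMl YW.
by rewrite (_ : ip (Y *m X) W = ip X (W *m Y)) ?subrr // ipC -ipMl ipC.
Qed.

(** As [rplus N - rminus N = N], the left side is <a - P, N>. Since [N] commutes with [J], <P, N> =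
    0, which trades - <P^-, N^-> for <P^+, N^+>; the right side unfolds by <dF, [Z, J]> = - <P,
    Z>. *)
Lemma bracket_reduced_commuting N : J *m N = N *m J ->
  ip (J *m dF - dF *m J) (rplus N - rminus N) + ip a (rplus N - rminus N) =
  ip D (pminus0 N) + ip dF (comm (Rq q (pminus N) - pplus N) J).
Proof.
move=> JN; have -> : rplus N - rminus N = N.
  by rewrite /rplus /rminus opprB addrC addrA subrK -scalerDl rc2V scale1r.
have h0 := ip_commutator dF JN; rewrite ip_pm in h0.
have -> : ip (J *m dF - dF *m J) N + ip a N =
    ip D (pminus N) + ip (Rq q (pplus P)) (pminus N) - ip (pminus P) (pminus N).
  by rewrite -ipDl addrC -[J *m dF - _]opprB (ip_hermitian_l _ aP) pminusB am ipBl ipDl.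
have -> : ip dF (comm (Rq q (pminus N) - pplus N) J) =
    ip P (pplus N) - ip P (Rq q (pminus N)).
  rewrite [comm (_ - _) _]/comm ipBr ipMC -ipMl -ipBl -[J *m dF - _]opprB -/P ipNl.
  by rewrite ipBr opprB.
have -> : ip P (pplus N) = ip (pplus P) (pplus N).
  by rewrite -{1}(pplus_pminus P) ipDl (ipC (pminus P)) ip_pplus_pminus addr0.
have -> : ip P (Rq q (pminus N)) = - ip (Rq q (pplus P)) (pminus N).
  rewrite -[LHS]opprK -ip_Rq -{1}(pplus_pminus (Rq q P)) ipDl ip_pplus_pminus add0r.
  by rewrite !RqE pminus_schur //; exact: RcoefN.
rewrite /pminus0 (ip_diag_dgp _ dD) opprK -addrA; congr (_ + _).
by rewrite addrC; congr (_ + _); apply/eqP; rewrite eq_sym -addr_eq0; apply/eqP.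
Qed.

End Bracket.
End ReducedBracketAlgebra.

(** * Gradients of invariant functions at the diagonal points [e^q] *)

Section ReducedGradients.
Variables (R : realType) (n : nat) (q : 'rV[R]_n).
Local Notation Mx := 'M[R[i]]_n.
Implicit Types (F : Mx * Mx -> R) (D X J a : Mx).

Lemma mulmx_expq X i j : (X *m expq q) i j = X i j * rc (expR (q 0 j)).
Proof. by rewrite /expq mul_mx_diag !mxE. Qed.

Lemma expq_mulmx X i j : (expq q *m X) i j = rc (expR (q 0 i)) * X i j.
Proof. by rewrite /expq mul_diag_mx !mxE. Qed.

Lemma unitmx_expq : expq q \in unitmx.
Proof.
rewrite unitmxE det_diag unitfE prodf_seq_neq0; apply/allP => i _ /=.
by rewrite !mxE /rc eq_complex /= eqxx andbT expR_eq0.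
Qed.

Lemma mderiv_expq i :
  mderiv (fun t => expq (q + t *: delta_mx 0 i)) (rc (expR (q 0 i)) *: delta_mx i i).
Proof.
move=> j k; have [jk|jk] := eqVneq j k; last first.
  apply: (cderiv_ext (cderiv_cst 0)) => [t|].
    by rewrite !mxE (negbTE jk) mulr0n.
  rewrite !mxE; have [ji|ji] := eqVneq j i; last by rewrite mulr0.
  by have [ki|ki] := eqVneq k i; rewrite /= ?mulr0 //; rewrite ji ki eqxx in jk.
rewrite -{}jk; have [->|ji] := eqVneq j i.
  have dq : is_derive (0 : R) 1 (fun t : R => q 0 i + t) 1.
    have c0 : is_derive (0 : R) 1 (fun=> q 0 i) 0 by exact: is_derive_cst.
    by apply: (is_derive_ext (is_deriveD c0 (is_derive_id _ _))) => //; rewrite add0r.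
  have de := is_derive1_comp (is_derive_expR (q 0 i + 0)) dq.
  apply: (cderiv_ext (cderiv_rc de)) => [t|].
    by rewrite !mxE !eqxx mulr1n /= mulr1.
  by rewrite !mxE !eqxx addr0 !mulr1.
apply: (cderiv_ext (cderiv_cst (rc (expR (q 0 j))))) => [t|].
  by rewrite !mxE !eqxx /= (negbTE ji) mulr0 addr0 mulr1n.
by rewrite !mxE (negbTE ji) mulr0.
Qed.

Lemma rnabla1E F J : smooth F ->
  rnabla1 (restr F) q J = diag_mx (\row_i rc (complex.Re (nabla1 F (expq q) J i i))).
Proof.
move=> sF; rewrite nabla1E ?unitmx_expq //; congr diag_mx.
apply/rowP => i; rewrite mxE [RHS]mxE; congr rc.
have q0 : expq (q + 0 *: delta_mx 0 i) = expq q by rewrite scale0r addr0.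
apply: is_derive_derive1.
apply: (is_derive_ext (chain_rule sF unitmx_expq q0 (erefl J) (mderiv_expq i) (mderiv_cst J))) => //.
move: (gradD1 _ _) (gradD2 _ _) => D1 D2.
by rewrite ip0r addr0 ipZr ip_delta expq_mulmx Re_rcM.
Qed.

Lemma is_diag_rnabla1 (f : 'rV[R]_n -> Mx -> R) J : offdiag0 (rnabla1 f q J).
Proof. by move=> i j ij; rewrite !mxE (negbTE ij). Qed.

Lemma rc_expRB (x y : R) : rc (expR (x - y)) * rc (expR y) = rc (expR x).
Proof. by rewrite /rc -rmorphM -expRD subrK. Qed.

Section Conjugate.
Variables (a a' : Mx).
Hypothesis aa' : a *m expq q = expq q *m a'.

Lemma conj_expqE i j : a i j = rc (expR (q 0 i - q 0 j)) * a' i j.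
Proof.
have := congr1 (fun M : Mx => M i j) aa'; rewrite mulmx_expq expq_mulmx.
rewrite -(rc_expRB (q 0 i) (q 0 j)) mulrAC => /mulIf -> //.
by rewrite /rc eq_complex /= eqxx andbT expR_eq0.
Qed.

Hypothesis a'_herm : adj a' = a'.

Lemma conj_expq_adj i j : conjc (a j i) = rc (expR (q 0 j - q 0 i)) * a' i j.
Proof.
rewrite conj_expqE -[in RHS]a'_herm mxE mxE.
case: (a' j i) => x y; apply/eqP; rewrite eq_complex /=.
by apply/andP; split; apply/eqP; ring.
Qed.

(** With x = q_i - q_j, [a_ij = e^x a'_ij] and [conj(a_ji) = e^-x a'_ij]; hence off the diagonal a^-
    and a^+ have entries [cosh x a'_ij] and [sinh x a'_ij], of ratio [coth x]. *)
Lemma pminus_conj_expq : regular q ->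
  pminus a = diag_mx (\row_i rc (complex.Re (a i i))) + Rq q (pplus a).
Proof.
move=> rq; apply/matrixP => i j; rewrite !mxE.
have [<-|ij] := eqVneq i j.
  rewrite mulr1n addr0; case: (a i i) => x y; apply/eqP.
  by rewrite eq_complex /=; apply/andP; split; apply/eqP; field.
rewrite mulr0n add0r conj_expq_adj (conj_expqE i j) -[q 0 j - _]opprB.
set x := q 0 i - q 0 j.
(* The denominator of [coth x]; regularity keeps q_i and q_j apart for i <> j. *)
have x0 : expR x - expR (- x) != 0.
  rewrite subr_eq0; apply: contra ij => /eqP/expR_inj xx.
  have {}xx : x = 0 by lra.
  have /eqP := xx; rewrite subr_eq0 => /eqP qij.
  have [h|h|/val_inj -> //] := ltngtP i j; have := rq _ _ h; rewrite qij ltxx.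
    by [].
  by [].
have cE : rc (expR x) + rc (expR (- x)) = rc (coth x) * (rc (expR x) - rc (expR (- x))).
  by rewrite /rc -rmorphD -rmorphB -rmorphM /coth divfK.
rewrite -mulrDl cE; move: (rc _) (rc _) (rc _) (rc _) => h c u v; ring.
Qed.

End Conjugate.

(** The pairing multiplies entries (i, j) by entries (j, i), whose factors e^(q_i - q_j) and e^(q_j
    - q_i) cancel. This removes the first two terms of the bracket. *)
Lemma ip_rmat_conj_expq (a a' b b' : Mx) :
  a *m expq q = expq q *m a' -> b *m expq q = expq q *m b' ->
  ip (rmat a) b = ip (rmat a') b'.
Proof.
move=> aa bb; rewrite !rmatE !ipE; apply: eq_bigr => i _; apply: eq_bigr => j _.
rewrite !mxE (conj_expqE aa) (conj_expqE bb); congr complex.Re.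
have e1 : rc (expR (q 0 i - q 0 j)) * rc (expR (q 0 j - q 0 i)) = 1 :> R[i].
  by rewrite /rc -rmorphM -expRD addrA subrK subrr expR0.
by rewrite -[RHS]mul1r -e1; move: (rc _) (rc _) (rc _) => u v w; ring.
Qed.

Section Invariant.
Variables (F : Mx * Mx -> R) (J : Mx).
Hypotheses (sF : smooth F) (iF : UUinvariant F).

Lemma nabla1_expq :
  nabla1 F (expq q) J *m expq q = expq q *m nabla1' F (expq q) J.
Proof. by rewrite nabla1E ?nabla1'E ?unitmx_expq // mulmxA. Qed.

Lemma nabla1_comm_hermitian :
  adj (nabla1 F (expq q) J - comm (d2 F (expq q) J) J) =
  nabla1 F (expq q) J - comm (d2 F (expq q) J) J.
Proof.
by apply: hermitian_of_skew => A sA A3; exact: nabla1_skew sF iF unitmx_expq sA A3.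
Qed.

Lemma pminus_nabla1 : regular q ->
  pminus (nabla1 F (expq q) J) =
  rnabla1 (restr F) q J + Rq q (pplus (comm (d2 F (expq q) J) J)).
Proof.
move=> rq; rewrite rnabla1E // -(pplus_of_hermitian_sub nabla1_comm_hermitian).
apply: (pminus_conj_expq nabla1_expq _ rq); apply: hermitian_of_skew => A sA A3.
exact: nabla1'_skew sF iF unitmx_expq sA A3.
Qed.

End Invariant.

End ReducedGradients.

(** * Gradients of the trace powers *)

Section TracePowers.
Variables (R : realType) (n : nat).
Local Notation Mx := 'M[R[i]]_n.
Implicit Types (X J g : Mx).

(** Without commutativity only traces of the derivative [W] simplify, so [W] stays unspecified. The
    free exponent [j] makes the induction work: the factor split off from the power raises it by
    one. *)
Lemma mderiv_exp (c : R -> Mx) (V : Mx) k : mderiv c V ->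
  exists2 W, mderiv (fun t => c t ^+ k) W &
    forall j, \tr (c 0 ^+ j *m W) = k%:R * \tr (c 0 ^+ (j + k).-1 *m V).
Proof.
move=> cV; elim: k => [|k [W cW tW]].
  exists 0; first by apply: (mderiv_ext (mderiv_cst 1)).
  by move=> j; rewrite mulmx0 linear0 mul0r.
exists (V *m c 0 ^+ k + c 0 *m W).
  by apply: (mderiv_ext (mderivM cV cW)) => // t; rewrite exprS.
move=> j; rewrite mulmxDr linearD /= [X in X + _ = _](_ : _ = \tr (c 0 ^+ k *m c 0 ^+ j *m V)).
  rewrite [c 0 ^+ k *m c 0 ^+ j](_ : _ = c 0 ^+ (j + k)); last by rewrite addnC exprD.
  rewrite [c 0 ^+ j *m (c 0 *m W)](_ : _ = c 0 ^+ j.+1 *m W); last first.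
    by rewrite mulmxA exprSr.
  by rewrite tW addSn addnS /= mulrS mulrDl mul1r.
by rewrite mulmxA mxtrace_mulC mulmxA.
Qed.

Lemma cderiv_trace_exp J X k :
  cderiv (fun t => \tr ((J + rc t *: X) ^+ k)) (k%:R * \tr (J ^+ k.-1 *m X)).
Proof.
have [W cW tW] := mderiv_exp k (mderiv_line J X).
have := tW 0%N; rewrite expr0 mul1mx /rc scale0r addr0 add0n => <-.
exact: cderiv_sum.
Qed.

Lemma ReMn (k : nat) (z : R[i]) : complex.Re (k%:R * z) = k%:R * complex.Re z.
Proof. by rewrite -Re_rcM /rc rmorph_nat. Qed.

Lemma ImMn (k : nat) (z : R[i]) : complex.Im (k%:R * z) = k%:R * complex.Im z.
Proof. by rewrite -Im_rcM /rc rmorph_nat. Qed.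

Lemma is_derive_scale (s : R) (f : R -> R) (x d : R) : is_derive x 1 f d ->
  is_derive x 1 (fun t => s * f t) (s * d).
Proof. by move=> fd; apply: (is_derive_ext (is_deriveZ s fd)). Qed.

Lemma d2_Hk k g J : (0 < k)%N -> d2 (@Hk R n k) g J = J ^+ k.-1.
Proof.
move=> k0; apply: eq_grad => z a b _; apply: is_derive_derive1.
have [H _] := cderiv_trace_exp J (z *: delta_mx a b) k.
apply: (is_derive_ext (is_derive_scale k%:R^-1 H)) => //.
by rewrite ReMn mulKf // pnatr_eq0 -lt0n.
Qed.

(** The factor comes from Im z = Re(- i z). *)
Lemma d2_Htk k g J : (0 < k)%N -> d2 (@Htk R n k) g J = - 'i *: J ^+ k.-1.
Proof.
move=> k0; apply: eq_grad => z a b _; apply: is_derive_derive1.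
have [_ H] := cderiv_trace_exp J (z *: delta_mx a b) k.
apply: (is_derive_ext (is_derive_scale k%:R^-1 H)) => //.
rewrite ImMn mulKf ?pnatr_eq0 -?lt0n // /ip -scalemxAl mxtraceZ.
by rewrite ReM /= oppr0 mul0r sub0r mulN1r opprK.
Qed.

Lemma nabla1_snd (h : Mx -> R) g J : nabla1 (fun p => h p.2) g J = 0.
Proof. by apply: eq_grad => z a b _; rewrite ip0l; apply: is_derive_derive1 => /=; exact: is_derive_cst. Qed.

Lemma nabla1'_snd (h : Mx -> R) g J : nabla1' (fun p => h p.2) g J = 0.
Proof. by apply: eq_grad => z a b _; rewrite ip0l; apply: is_derive_derive1 => /=; exact: is_derive_cst. Qed.

Lemma power_sum_gradient k (H : Mx * Mx -> R) g J : (0 < k)%N ->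
  H = @Hk R n k \/ H = @Htk R n k ->
  [/\ nabla1 H g J = 0, nabla1' H g J = 0, nabla2 H g J = nabla2' H g J &
      J *m nabla2 H g J = nabla2 H g J *m J].
Proof.
move=> k0 HH.
have [w d2H] : exists w, d2 H g J = w *: J ^+ k.-1.
  case: HH => ->; [exists 1 | exists (- 'i)]; last exact: d2_Htk.
  by rewrite scale1r d2_Hk.
have N : nabla2 H g J = w *: J ^+ k.
  by rewrite /nabla2 d2H -scalemxAr -[J *m _]exprS prednK.
have N' : nabla2' H g J = w *: J ^+ k.
  by rewrite /nabla2' d2H -scalemxAl -[_ *m J]exprSr prednK.
split; [| |by rewrite N N'|].
- case: HH => ->; first exact: (nabla1_snd (fun X => k%:R^-1 * complex.Re (\tr (X ^+ k)))).
  exact: (nabla1_snd (fun X => k%:R^-1 * complex.Im (\tr (X ^+ k)))).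
- case: HH => ->; first exact: (nabla1'_snd (fun X => k%:R^-1 * complex.Re (\tr (X ^+ k)))).
  exact: (nabla1'_snd (fun X => k%:R^-1 * complex.Im (\tr (X ^+ k)))).
- by rewrite N -scalemxAr -scalemxAl -[J *m _]exprS -[_ *m J]exprSr.
Qed.

End TracePowers.

Theorem theorem3p5 (R : realType) (n : nat) :
  (* first formula: f = F o iota, h = H o iota with F, H smooth U(n) x U(n)-invariant *)
  (forall F H : 'M[R[i]]_n * 'M[R[i]]_n -> R,
    smooth F -> UUinvariant F -> smooth H -> UUinvariant H ->
    forall (q : 'rV[R]_n) (J : 'M[R[i]]_n), regular q ->
    let f := restr F in let h := restr H in
    2 * bracket2 F H (expq q) J =
        ip (rnabla1 f q J) (pminus0 (rnabla2 h q J + rnabla2' h q J))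
      - ip (rnabla1 h q J) (pminus0 (rnabla2 f q J + rnabla2' f q J))
      + ip (Rq q (pplus (comm (rd2 f q J) J))) (pminus (rnabla2 h q J + rnabla2' h q J))
      - ip (Rq q (pplus (comm (rd2 h q J) J))) (pminus (rnabla2 f q J + rnabla2' f q J))
      + ip (pminus (rnabla2 f q J)) (pminus (rnabla2' h q J))
      + ip (pplus (rnabla2' f q J)) (pplus (rnabla2 h q J))
      - ip (pminus (rnabla2' f q J)) (pminus (rnabla2 h q J))
      - ip (pplus (rnabla2 f q J)) (pplus (rnabla2' h q J)))
  /\
  (* second formula: h = H_k o iota or h = ~H_k o iota, k >= 1 *)
  (forall F : 'M[R[i]]_n * 'M[R[i]]_n -> R,
    smooth F -> UUinvariant F ->
    forall k : nat, (1 <= k)%N ->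
    forall H, (H = @Hk R n k \/ H = @Htk R n k) ->
    forall (q : 'rV[R]_n) (J : 'M[R[i]]_n), regular q ->
    let f := restr F in let h := restr H in
    bracket2 F H (expq q) J =
        ip (rnabla1 f q J) (pminus0 (rnabla2 h q J))
      + ip (rd2 f q J) (comm (Rq q (pminus (rnabla2 h q J)) - pplus (rnabla2 h q J)) J)).
Proof.
split.
  move=> F H sF iF sH iH q J rq f h.
  rewrite /bracket2.
  have h1 := ip_rmat_conj_expq (nabla1_expq q J sF) (nabla1_expq q J sH).
  (* [rd2 (restr F) q J] is convertible to [d2 F (expq q) J], so the algebraic identity applies as
     it stands. *)
  exact: (bracket_reduced (nabla1_comm_hermitian q J sF iF) (nabla1_comm_hermitian q J sH iH)
    (pminus_nabla1 J sF iF rq) (pminus_nabla1 J sH iH rq)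
    (is_diag_rnabla1 q f J) (is_diag_rnabla1 q h J) h1).
move=> F sF iF k k0 H HH q J rq f h.
have [b0 b'0 NN' JN] := power_sum_gradient (expq q) J k0 HH.
apply: etrans (bracket_zero_nabla1 _ _ _ _ _ b0 b'0 NN') _.
exact: (bracket_reduced_commuting (nabla1_comm_hermitian q J sF iF)
  (pminus_nabla1 J sF iF rq) (is_diag_rnabla1 q f J) JN).
Qed.
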